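(* Consider the Frank–Wolfe stochastic approximation (FWSA) iteration described in the context for $\min_{\mathbf p\in\mathcal U}Z(\mathbf p)$. Let $\hat\psi$ be one of the gradient estimators SFE, FFE, CFE, FD$_{standard}$, FD$_{random}$, with expectation $E[\hat\psi]=\psi$, and with a corresponding set of parameters, that for $c$ small enough satisfies $$\|\psi(\mathbf p)-\nabla Z(\mathbf p)-\epsilon_0(\mathbf p)\mathbf 1\|\le B_1c$$ for some $\epsilon_0(\mathbf p)\in\mathbb R$ that depends on $\mathbf p$, and $$E[\|\hat\psi-\psi\|^2]\le B_2\frac{\gamma}{Rc^2}.$$ Suppose we choose the update step size as $\epsilon_k=a/k$ for some $a\le 1/2$, and the perturbation size as $c_k=b/k^\theta$ for some $\theta$. For each iteration, the number of simulation replications is $R_k=[R_0k^\beta]+1$ where $\beta>2(a+\theta)$. In addition, choose $\gamma_k=\gamma_0\big(\min_{i\in[m]}\min_{j\in[n^i]}p^i_{k,j}\big)^{-2}$. Then, with this configuration, under assumptions (A1), (A2) and (A3), $D(Z(\mathbf p_k),\mathcal L^* )\to0$ almost surely, where $\mathcal L^*=\{Z(\mathbf p):\mathbf p\text{ satisfies }g(\mathbf p)=0\}$ and $D(x,A)=\inf_{y\in A}\|x-y\|$ for any point $x$ and set $A$ in Euclidean space. In addition, if (A4) also holds, then $\mathbf p_k$ converges to $\mathbf p^*$ almost surely.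
   Context: Setting. $[N]=\{1,\dots,N\}$. For $i\in[m]$, $\mathcal P^{n^i}$ is the probability simplex in $\mathbb R^{n^i}$; $Z:\prod_{i=1}^m\mathcal P^{n^i}\to\mathbb R$; $\mathbf p=vec(\mathbf p^1,\dots,\mathbf p^m)$ is the concatenation of $\mathbf p^i=(p^i_1,\dots,p^i_{n^i})\in\mathcal P^{n^i}$. $\mathcal U=\prod_{i=1}^m\mathcal U^i$, where $\mathcal U^i\subseteq\mathcal P^{n^i}$ is the uncertainty set for $\mathbf p^i$. $\|\cdot\|$ is the Euclidean norm (spectral norm for matrices), $\mathbf 1$ the all-ones vector, $\mathbf e_j$ a standard basis vector, $[x]$ (for a real number $x$ in the formula for $R_k$) the integer part of $x$. $B_1,B_2$ are constants and $b,R_0,\gamma_0$ are constants chosen by the user. Derivatives. $\nabla Z(\mathbf p)=vec(\nabla_{\mathbf p^i}Z(\mathbf p):i\in[m])$, where $\nabla Z$ satisfies $Z(\mathbf q)-Z(\mathbf p)=\nabla Z(\mathbf p)'(\mathbf q-\mathbf p)+o(\|\mathbf q-\mathbf p\|)$ for feasible $\mathbf q$, in the version whose $(i,j)$ component is the limit, as $\epsilon\to0_+$, of $\epsilon^{-1}$ times the increment of $Z$ when $\mathbf p^i$ is replaced by $(1-\epsilon)\mathbf p^i+\epsilon\mathbf e_j$ (other blocks fixed). Second derivatives and $\nabla^2Z$ are defined recursively by the same limits. Assumptions. (A1) $Z$ is $\mathcal C^2$, $Z$ is $L_0$-Lipschitz, $\nabla Z$ is $L_1$-Lipschitz, and $\nabla^2Z$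 is $L_2$-Lipschitz. (A2) The noisy function evaluation is unbiased, $E[\hat Z(\mathbf p)]=Z(\mathbf p)$, and its variance $\mathrm{Var}[\hat Z(\mathbf p)]$ is bounded by $\sigma^2>0$. (A3) The Frank–Wolfe gap $g:\prod_i\mathcal P^{n^i}\to\mathbb R$, $g(\mathbf p)=-\min_{\mathbf q\in\mathcal U}\nabla Z(\mathbf p)'(\mathbf q-\mathbf p)$, is continuous and an optimal solution exists. (A4) There exists a unique minimizer $\mathbf p^*$ for $\min_{\mathbf p\in\mathcal U}Z(\mathbf p)$, and $\mathbf p^*$ is the only feasible solution such that $g(\mathbf p^* )=0$. Gradient estimators at $\mathbf p$, with perturbation size $c>0$, $R$ replications and multiplier $\gamma$. With $\boldsymbol\delta^1,\dots,\boldsymbol\delta^R$ independent draws of a random $\boldsymbol\delta\in\prod_i\mathcal P^{n^i}$, independent evaluations $\hat Z^j$, and score function $S(\mathbf p,\boldsymbol\delta)=\gamma(\boldsymbol\delta-\mathbf p)$: SFE is $\frac1R\sum_j\frac{\hat Z^j((1-c)\mathbf p+c\boldsymbol\delta^j)}{c}S(\mathbf p,\boldsymbol\delta^j)$; FFE is $\frac1R\sum_j\frac{\hat Z^{2j-1}((1-c)\mathbf p+c\boldsymbol\delta^j)-\hat Z^{2j}(\mathbf p)}{c}S(\mathbf p,\boldsymbol\delta^j)$; CFE is $\frac1R\sum_j\frac{\hat Z^{2j-1}((1-c)\mathbf p+c\boldsymbol\delta^j)-\hat Z^{2j}((1+c)\mathbf p-c\boldsymbol\delta^j)}{2c}S(\mathbf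 p,\boldsymbol\delta^j)$. FD$_{standard}$ estimates each coordinate $(i,j)$ by an average of independent forward differences $\frac{\hat Z(\mathbf p\text{ with }\mathbf p^i\text{ replaced by }\mathbf p^i+c(\mathbf e_j-\mathbf p^i))-\hat Z(\mathbf p)}{c}$, the $R$ replications being split equally among the $n=\sum_in^i$ coordinates; FD$_{random}$ is the average over $R$ independent replications of $n$ times such a forward difference along a uniformly random coordinate, times the corresponding unit vector. FWSA. Start with $\mathbf p_1\in\mathcal U$. At iteration $k$, given $\mathbf p_k$ (with entries $p^i_{k,j}$), compute $\hat\psi(\mathbf p_k)$ with $c_k,R_k,\gamma_k$ in the roles of $c,R,\gamma$, using newly generated perturbations and function evaluations; choose $\hat{\mathbf q}_k\in\arg\min_{\mathbf q\in\mathcal U}\hat\psi(\mathbf p_k)'(\mathbf q-\mathbf p_k)$; set $\mathbf p_{k+1}=(1-\epsilon_k)\mathbf p_k+\epsilon_k\hat{\mathbf q}_k$.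
   Formalization: The sets U^i are taken closed and convex, the constants a, b, θ, R_0, γ_0 positive, and p_1 with positive entries; without these the iterates may leave U or converge outside it, the bias need not vanish, or γ_1 is undefined. *)

(* Defs.v *)
(* MathComp-Analysis development, over an arbitrary realType. *)
From HB Require Import structures.
From mathcomp Require Import all_boot all_order all_algebra finmap.
From mathcomp Require Import all_classical all_reals all_analysis.

Set Implicit Arguments.
Unset Strict Implicit.
Unset Printing Implicit Defensive.

Import Order.TTheory GRing.Theory Num.Theory.
Import numFieldTopology.Exports numFieldNormedType.Exports.

Local Open Scope classical_set_scope.
Local Open Scope ring_scope.

Section vectors.
Context {R : realType} {N : nat}.
Implicit Types u v : 'rV[R]_N.

Definition dot u v : R := \sum_x u 0 x * v 0 x.

(* The library norm on matrices is the max norm, hence this one. *)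
Definition enorm v : R := Num.sqrt (\sum_x v 0 x ^+ 2).

Definition spectral_norm (A : 'M[R]_N) : R :=
  sup [set enorm (v *m A) | v in [set v : 'rV[R]_N | enorm v <= 1]].

Definition lipschitz_wrt (T : zmodType) (nrm : T -> R) (D : set 'rV[R]_N)
    (f : 'rV[R]_N -> T) (L : R) : Prop :=
  forall p q, D p -> D q -> nrm (f p - f q) <= L * enorm (p - q).

Definition simplex : set 'rV[R]_N :=
  [set u | (forall j, 0 <= u 0 j) /\ \sum_j u 0 j = 1].

(* On a product of simplices all entries are at most 1, so starting the
   iterated minimum at 1 yields the smallest entry. *)
Definition min_entry v : R := \big[Num.min/1]_x v 0 x.

End vectors.

(* A vector p = vec(p^1, ..., p^m) is a row of length \sum_i n i; its block p^i
   is [submxrow p i], and a flat index x stands for the pair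
   (tagnat.sig1 x, tagnat.sig2 x). *)
Section blocks.
Context {R : realType} {m : nat} {n : 'I_m -> nat}.
Local Notation N := (\sum_i n i)%N.
Implicit Types (p q : 'rV[R]_N) (x y : 'I_N) (F : 'rV[R]_N -> R).

Definition prod_set (A : forall i, set 'rV[R]_(n i)) : set 'rV[R]_N :=
  [set p | forall i, A i (submxrow p i)].

Definition simplices : set 'rV[R]_N := prod_set (fun=> simplex).

(* For x = (i, j): p with its block p^i replaced by (1 - e) p^i + e e_j. *)
Definition mix_block p x (e : R) : 'rV[R]_N :=
  \row_y (if tagnat.sig1 y == tagnat.sig1 x
          then (1 - e) * p 0 y + e * (y == x)%:R else p 0 y).

Definition incr_quot F p x (e : R) : R := e^-1 * (F (mix_block p x e) - F p).

Definition grad F p : 'rV[R]_N := \row_x lim (incr_quot F p x e @[e --> 0^'+]).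

Definition hess F p : 'M[R]_N :=
  \matrix_(x, y) grad (fun q => grad F q 0 y) p 0 x.

Record C2 F : Prop := {
  C2_grad : forall p x, simplices p -> cvg (incr_quot F p x e @[e --> 0^'+]);
  C2_expansion : forall p, simplices p ->
    forall eta : R, 0 < eta -> exists2 d : R, 0 < d &
      forall q, simplices q -> enorm (q - p) < d ->
        `|F q - F p - dot (grad F p) (q - p)| <= eta * enorm (q - p);
  C2_hess : forall p x y, simplices p ->
    cvg (incr_quot (fun q => grad F q 0 y) p x e @[e --> 0^'+]);
  C2_continuous : {within simplices, continuous F};
  C2_grad_continuous : {within simplices, continuous (grad F)};
  C2_hess_continuous : {within simplices, continuous (hess F)} }.

Record smooth_objective F (L0 L1 L2 : R) : Prop := {
  objective_C2 : C2 F;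
  objective_lipschitz : lipschitz_wrt Num.norm simplices F L0;
  gradient_lipschitz : lipschitz_wrt enorm simplices (grad F) L1;
  hessian_lipschitz : lipschitz_wrt spectral_norm simplices (hess F) L2 }.

Definition linear_argmin (S : set 'rV[R]_N) (d : 'rV[R]_N) p : set 'rV[R]_N :=
  [set q | S q /\ forall r, S r -> dot d (q - p) <= dot d (r - p)].

Definition FW_gap F (S : set 'rV[R]_N) p : R :=
  - inf [set dot (grad F p) (q - p) | q in S].

(* "An optimal solution exists" is recorded both for the linear subproblem
   defining the gap and for the minimization of F itself. *)
Record regular_gap F (S : set 'rV[R]_N) : Prop := {
  gap_continuous : {within simplices, continuous (FW_gap F S)};
  gap_attained : forall p, simplices p -> linear_argmin S (grad F p) p !=set0;
  objective_attained : exists2 p, S p & forall q, S q -> F p <= F q }.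

Record unique_stationary_minimizer F (S : set 'rV[R]_N) (pstar : 'rV[R]_N)
    : Prop := {
  pstar_feasible : S pstar;
  pstar_minimizes : forall p, S p -> p != pstar -> F pstar < F p;
  pstar_stationary : forall p, S p -> (FW_gap F S p = 0 <-> p = pstar) }.

Definition stationary_values F (S : set 'rV[R]_N) : set R :=
  [set F p | p in [set p | S p /\ FW_gap F S p = 0]].

End blocks.

Definition dist_set {R : realType} (x : R) (A : set R) : \bar R :=
  ereal_inf [set (`|x - y|)%:E | y in A].

(* A random object whose law depends on a parameter is represented as a jointly
   measurable function of the parameter and of a random seed of fixed law. *)
Section oracle.
Context {R : realType} {N : nat} {d : measure_display} {T : measurableType d}.

Definition jointly_measurable (f : 'rV[R]_N -> T -> R) : Prop :=
  measurable_fun [set: N.-tuple R * T]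
    (fun z : N.-tuple R * T => f (\row_x tnth z.1 x) z.2).

Record noisy_evaluation (Q : probability T R) (D : set 'rV[R]_N)
    (Z : 'rV[R]_N -> R) (Zhat : 'rV[R]_N -> T -> R) (sigma : R) : Prop := {
  noisy_measurable : jointly_measurable Zhat;
  noisy_unbiased : forall p, D p -> ('E_Q[Zhat p] = (Z p)%:E)%E;
  noisy_variance : forall p, D p -> (variance Q (Zhat p) <= (sigma ^+ 2)%:E)%E }.

Record perturbation (D : set 'rV[R]_N)
    (delta : R -> 'rV[R]_N -> T -> 'rV[R]_N) : Prop := {
  perturbation_measurable :
    forall c x, jointly_measurable (fun p e => delta c p e 0 x);
  perturbation_in : forall c p e, D p -> D (delta c p e) }.

End oracle.

Inductive estimator_kind := SFE | FFE | CFE | FD_standard | FD_random.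

(* The estimator at p with perturbation size c, Rn replications and multiplier
   gam.  Replications and function evaluations are counted from 0: replication t
   uses the perturbation seed eta t (or the random coordinate J t) and the noise
   seeds xi t (SFE) or xi (2 * t), xi (2 * t + 1) (other kinds).  FD_standard
   assigns replication t to coordinate t mod N, which splits the Rn replications
   equally up to rounding. *)
Section estimators.
Context {R : realType} {m : nat} {n : 'I_m -> nat}.
Local Notation N := (\sum_i n i)%N.
Context {E X : Type}.
Variables (Zhat : 'rV[R]_N -> X -> R) (delta : R -> 'rV[R]_N -> E -> 'rV[R]_N).

Definition estimator (kind : estimator_kind) (c : R) (Rn : nat) (gam : R)
    (p : 'rV[R]_N) (eta : nat -> E) (J : nat -> 'I_N) (xi : nat -> X)
    : 'rV[R]_N :=
  let del t := delta c p (eta t) in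
  let score t := gam *: (del t - p) in
  let fwd t := (1 - c) *: p + c *: del t in
  let bwd t := (1 + c) *: p - c *: del t in
  let xi1 t := xi (2 * t)%N in
  let xi2 t := xi (2 * t + 1)%N in
  let fd x t := (Zhat (mix_block p x c) (xi1 t) - Zhat p (xi2 t)) / c in
  match kind with
  | SFE => Rn%:R^-1 *: \sum_(t < Rn) (Zhat (fwd t) (xi t) / c) *: score t
  | FFE => Rn%:R^-1 *: \sum_(t < Rn)
      ((Zhat (fwd t) (xi1 t) - Zhat p (xi2 t)) / c) *: score t
  | CFE => Rn%:R^-1 *: \sum_(t < Rn)
      ((Zhat (fwd t) (xi1 t) - Zhat (bwd t) (xi2 t)) / (2 * c)) *: score t
  | FD_standard => \row_x ((\sum_(t < Rn | (t %% N)%N == x) 1)^-1 *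
      \sum_(t < Rn | (t %% N)%N == x) fd x t)
  | FD_random => Rn%:R^-1 *: \sum_(t < Rn)
      (N%:R * fd (J t) t) *: delta_mx 0 (J t)
  end.

(* FD_standard needs at least one replication for each coordinate. *)
Definition enough_replications (kind : estimator_kind) (Rn : nat) : bool :=
  if kind is FD_standard then (N <= Rn)%N else (1 <= Rn)%N.

End estimators.

Section randomness.
Context {R : realType} {d : measure_display} {Om : measurableType d}
  (P : probability Om R).

Definition mutually_independent (I : choiceType) (G : I -> set_system Om)
    : Prop :=
  forall (J : {fset I}) (A : I -> set Om), (forall i, i \in J -> G i (A i)) ->
    P (\bigcap_(i in [set` J]) A i) = (\prod_(i <- J) P (A i))%E.

Definition generated d' (T : measurableType d') (V : Om -> T) : set_system Om :=
  [set V @^-1` B | B in measurable].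

Definition filtration (F : nat -> set_system Om) : Prop :=
  [/\ forall k, sigma_algebra [set: Om] (F k), forall k, F k `<=` measurable
    & forall k, F k `<=` F k.+1].

Context {d1 d2 : measure_display} {E : measurableType d1} {X : measurableType d2}
  {N : nat}.

(* None is the past; the three summands are the perturbation seeds, the random
   coordinates and the noise seeds of one iteration. *)
Definition sources (past : set_system Om) (eta : nat -> Om -> E)
    (J : nat -> Om -> 'I_N) (xi : nat -> Om -> X)
    (s : option (nat + nat + nat)) : set_system Om :=
  match s with
  | None => past
  | Some (inl (inl t)) => generated (eta t)
  | Some (inl (inr t)) => [set J t @^-1` B | B in [set: set 'I_N]]
  | Some (inr t) => generated (xi t)
  end.

(* F k is the information available before iteration k, whose randomness
   eta k, J k, xi k is drawn afresh. *)
Record fresh_sampling (Qe : probability E R) (Qx : probability X R)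
    (F : nat -> set_system Om) (eta : nat -> nat -> Om -> E)
    (J : nat -> nat -> Om -> 'I_N) (xi : nat -> nat -> Om -> X) : Prop := {
  sampling_filtration : filtration F;
  sampling_revealed :
    forall k s, sources (F k) (eta k) (J k) (xi k) s `<=` F k.+1;
  sampling_eta_law : forall k t A, measurable A -> P (eta k t @^-1` A) = Qe A;
  sampling_J_law : forall k t x, P (J k t @^-1` [set x]) = (N%:R^-1)%:E;
  sampling_xi_law : forall k t A, measurable A -> P (xi k t @^-1` A) = Qx A;
  sampling_independent :
    forall k, mutually_independent (sources (F k) (eta k) (J k) (xi k)) }.

End randomness.

Section algorithm.
Context {R : realType} {m : nat} {n : 'I_m -> nat}.
Local Notation N := (\sum_i n i)%N.
Context {d d1 d2 : measure_display} {Om : measurableType d}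
  {E : measurableType d1} {X : measurableType d2}.
Variables (P : probability Om R) (Z : 'rV[R]_N -> R)
  (Zhat : 'rV[R]_N -> X -> R) (delta : R -> 'rV[R]_N -> E -> 'rV[R]_N)
  (kind : estimator_kind) (S : set 'rV[R]_N)
  (eta : nat -> nat -> Om -> E) (J : nat -> nat -> Om -> 'I_N)
  (xi : nat -> nat -> Om -> X).

Definition multiplier (gamma0 : R) (p : 'rV[R]_N) : R :=
  gamma0 * (min_entry p) ^- 2.

(* The estimator computed from the randomness of iteration k. *)
Definition psihat (k : nat) (c : R) (Rn : nat) (gam : R) (p : 'rV[R]_N)
    (w : Om) : 'rV[R]_N :=
  estimator Zhat delta kind c Rn gam p
    (fun t => eta k t w) (fun t => J k t w) (fun t => xi k t w).

(* Required at the feasible points with positive entries, where the multiplier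
   is meaningful.  The identity for the mean, whose right-hand side is finite,
   includes the integrability of the estimator.  The law of [psihat k] does not
   depend on k. *)
Definition estimator_bounds (gamma0 B1 B2 : R) (eps0 : 'rV[R]_N -> R) : Prop :=
  \forall c \near (0 : R)^'+, forall (k Rn : nat) (p : 'rV[R]_N),
    enough_replications (n := n) kind Rn -> S p -> (forall x, 0 < p 0 x) ->
    let gam := multiplier gamma0 p in
    let est := psihat k c Rn gam p in
    exists psi : 'rV[R]_N,
      [/\ forall x, ('E_P[fun w => est w 0%R x] = (psi 0%R x)%:E)%E,
          enorm (psi - grad Z p - const_mx (eps0 p)) <= B1 * c
        & ('E_P[fun w => (enorm (est w - psi) ^+ 2)%R] <=
           (B2 * (gam / (Rn%:R * c ^+ 2)))%:E)%E].

(* The iteration is indexed from 1; the values at 0 are irrelevant. *)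
Record FWSA (F : nat -> set_system Om) (eps c : nat -> R) (Rn : nat -> nat)
    (gam : 'rV[R]_N -> R) (p1 : 'rV[R]_N) (p qhat : nat -> Om -> 'rV[R]_N)
    : Prop := {
  FWSA_start : forall w, p 1%N w = p1;
  FWSA_direction : forall k w, (0 < k)%N ->
    linear_argmin S (psihat k (c k) (Rn k) (gam (p k w)) (p k w) w) (p k w)
      (qhat k w);
  FWSA_direction_measurable : forall k x, (0 < k)%N ->
    forall B : set R, measurable B ->
      F k.+1 ((fun w => qhat k w 0 x) @^-1` B);
  FWSA_step : forall k w, (0 < k)%N ->
    p k.+1 w = (1 - eps k) *: p k w + eps k *: qhat k w }.

End algorithm.

(* Main.v *)
Require Import Defs.
From HB Require Import structures.
From mathcomp Require Import all_boot all_order all_algebra finmap.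
From mathcomp Require Import all_classical all_reals all_analysis.
From mathcomp Require Import measurable_realfun ring lra.

Set Implicit Arguments.
Unset Strict Implicit.
Unset Printing Implicit Defensive.

Import Order.TTheory GRing.Theory Num.Theory.
Import numFieldTopology.Exports numFieldNormedType.Exports.

Local Open Scope classical_set_scope.
Local Open Scope ring_scope.

(* Feasible points have the same block sums, so shifting the estimated gradient
   by a multiple of the all-ones vector does not change the linear subproblem.
   Writing D_k for the difference between the estimator and the gradient at p_k,
   only the spread of the entries of D_k around one of them matters, and the
   bias eps0 drops out.

   The entries of p_k are at least C k^-a, hence gamma_k = O(k^(2a)) and the mean
   squared spread of D_k is O(k^(-2 r)) for some r > 0.  As the randomness of
   iteration k is independent of the past, this bound, known at fixed points,
   passes to the random point p_k by Tonelli.  With |y| <= k^-r + k^r y^2 the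
   errors eps_k |D_k| are almost surely summable, without conditional
   expectations or martingales.

   Pathwise, the descent inequality
     Z(p_(k+1)) <= Z(p_k) - eps_k g(p_k) + s_k,  sum of s_k finite,
   makes Z(p_k) converge and, the eps_k having an infinite sum, g(p_k) small
   infinitely often; a cluster point q along such times has g(q) = 0 and
   Z(q) = lim Z(p_k). *)

(** * Real sequences *)

Section real_sequences.
Context {R : realType}.

(** Concavity of [ln] between [1 - x] and [1], where [ln 1 = 0], followed by exponentiation. *)
Lemma powR_bernoulli (x r : R) : 0 <= x -> x < 1 -> 0 <= r -> r <= 1 ->
  (1 - x) `^ r <= 1 - r * x.
Proof.
move=> x0 x1 r0 r1.
have x1' : 0 < 1 - x by rewrite subr_gt0.
have rx : 0 < 1 - r * x.
  by rewrite subr_gt0 (le_lt_trans _ x1)// ler_piMl.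
pose t : {i01 R} := Itv01 r0 r1.
have := @concave_ln R t (1 - x : R^o) (1 : R^o) x1' ltr01.
rewrite !convRE /= /unstable.onem ln1 mulr0 addr0 mulr1 => H.
rewrite -ler_ln ?posrE ?powR_gt0// ln_powR; apply: (le_trans H).
by rewrite le_eqVlt; apply/orP; left; apply/eqP; congr ln; ring.
Qed.

Lemma powR_unbounded (r B : R) : 0 < r ->
  exists K, forall k, (K <= k)%N -> B < k%:R `^ r.
Proof.
move=> r0; pose y := (`|B| + 1) `^ r^-1.
exists (Num.truncn y).+1 => k Kk.
have yk : y < k%:R by apply: lt_le_trans (truncnS_gt y) _; rewrite ler_nat.
apply: (@lt_le_trans _ _ (`|B| + 1)); first by rewrite ltr_pwDr// ler_norm.
have -> : `|B| + 1 = y `^ r.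
  by rewrite -powRrM mulVf ?gt_eqF// powRr1// addr_ge0.
by apply: ge0_ler_powR; rewrite ?nnegrE ?powR_ge0// ltW.
Qed.

(** Bernoulli at [x = 1 / (k + 2)], for which [1 - x = (k + 1) / (k + 2)]. *)
Lemma powR_step (r : R) k : 0 <= r -> r <= 1 ->
  (k.+1%:R `^ r) <= (1 - r / k.+2%:R) * (k.+2%:R `^ r).
Proof.
move=> r0 r1.
have k2 : 0 < k.+2%:R :> R by [].
have := @powR_bernoulli (k.+2%:R^-1) r; rewrite invr_ge0 ler0n invf_lt1//.
rewrite ltr1n => /(_ isT isT r0 r1).
have -> : 1 - k.+2%:R^-1 = k.+1%:R / k.+2%:R :> R.
  apply: (mulIf (lt0r_neq0 k2)); rewrite mulrBl divfK ?mulVf ?lt0r_neq0//.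
  by rewrite mul1r -[in LHS]natr1 addrK.
rewrite powRM ?invr_ge0// -powR_inv1// -powRrM mulN1r powRN.
by rewrite ler_pdivrMr// powR_gt0.
Qed.

(** By [powR_step] each factor [1 - a / (k + 2)] is at least [((k + 1) / (k + 2))^a], and these
    ratios telescope. *)
Lemma product_decay (a : R) (u : nat -> R) :
  0 < a -> a <= 1 / 2 -> (0 < u 1%N) ->
  (forall k, (0 < k)%N -> (1 - a / k%:R) * u k <= u k.+1) ->
  forall k, (0 < k)%N -> (1 - a) * u 1%N * k%:R `^ (- a) <= u k.
Proof.
move=> a0 a2 u1 uS.
have a1 : a <= 1 by rewrite (le_trans a2)//; lra.
have c0 : 0 < (1 - a) * u 1%N by rewrite mulr_gt0// subr_gt0 (le_lt_trans a2)//; lra.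
(* The induction runs one index ahead: the factor [1 - a] of the first step becomes the constant,
   and the later factors telescope. *)
have main k : (1 - a) * u 1%N * k.+1%:R `^ (- a) <= u k.+2.
  elim: k => [|k IH].
    by have := uS 1%N isT; rewrite powR1 mulr1 divr1.
  apply: le_trans (uS k.+2 isT).
  apply: le_trans (ler_wpM2l _ IH); last first.
    by rewrite subr_ge0 ler_pdivrMr// mul1r (le_trans a1)// ler1n.
  rewrite mulrCA ler_pM2l// !powRN.
  rewrite ler_pdivlMr ?powR_gt0// mulrC ler_pdivrMr ?powR_gt0//.
  by apply: powR_step => //; exact: ltW.
case=> [//|[_|k _]]; last first.
  apply: le_trans (main k); rewrite ler_pM2l// !powRN lef_pV2 ?posrE ?powR_gt0//.
  by apply: ge0_ler_powR; rewrite ?nnegrE ?ler0n ?ler_nat// ltW.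
by rewrite powR1 mulr1 ler_piMl ?ltW// ltrBlDr ltrDl.
Qed.

(** Telescoping in place of an integral comparison: for [k >= 2], [k^-(1 + r)] is at most
    [r^-1 ((k - 1)^-r - k^-r)]. *)
Lemma sum_powR_le (r : R) n : 0 < r -> r <= 1 ->
  \sum_(1 <= k < n.+2) k%:R `^ (- (1 + r)) <= 1 + r^-1 * (1 - n.+1%:R `^ (- r)).
Proof.
move=> r0 r1; elim: n => [|n IH].
  by rewrite big_nat1 !powR1 subrr mulr0 addr0.
rewrite big_nat_recr//=; apply: le_trans (lerD IH (lexx _)) _.
rewrite -addrA lerD2l -lerBrDl -mulrBr ler_pdivlMl//.
have -> : 1 - n.+2%:R `^ (- r) - (1 - n.+1%:R `^ (- r)) =
    n.+1%:R `^ (- r) - n.+2%:R `^ (- r) by ring.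
set x := n.+2%:R; have x0 : 0 < x by [].
have y0 : 0 < n.+1%:R :> R by [].
have := @powR_step r n (ltW r0) r1; rewrite -/x => S.
have E : x `^ (- (1 + r)) = x^-1 * x `^ (- r).
  rewrite opprD powRD ?(gt_eqF x0) ?implybT// powR_inv1 ?ltW//.
rewrite E lerBrDr -{2}[x `^ (-r)]mul1r mulrA -mulrDl.
rewrite !powRN ler_pdivrMr ?powR_gt0// ler_pdivlMl ?powR_gt0//.
(* What remains is [(1 + t) (n + 1)^r <= x^r]; [powR_step] bounds [(n + 1)^r] by [(1 - t) x^r], and
   [(1 + t) (1 - t) <= 1]. *)
rewrite mulrC; set t := r / x in S *.
have t1 : t < 1.
  rewrite /t ltr_pdivrMr// mul1r (le_lt_trans r1)// ltr1n//.
have t0 : 0 <= t by rewrite divr_ge0// ltW.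
apply: le_trans (ler_wpM2l _ S) _; first by rewrite addr_ge0.
rewrite mulrA ler_piMl ?powR_ge0//.
have -> : (t + 1) * (1 - t) = 1 - t ^+ 2 by ring.
by rewrite gerBl sqr_ge0.
Qed.

Lemma sum_shifted_powR_le (r : R) K n : 0 < r -> r <= 1 -> (0 < K)%N ->
  \sum_(0 <= i < n) (K + i)%:R `^ (- (1 + r)) <= 1 + r^-1.
Proof.
move=> r0 r1 K0.
apply: (@le_trans _ _ (\sum_(1 <= k < K + n) k%:R `^ (- (1 + r)))).
  elim: n => [|n IH].
    by rewrite big_geq// sumr_ge0// => k _; exact: powR_ge0.
  by rewrite addnS !big_nat_recr ?addn_gt0 ?K0//= lerD2r.
have r0' : 0 <= r^-1 by rewrite invr_ge0 ltW.
case: (K + n)%N => [|[|k]]; try by rewrite big_geq// addr_ge0.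
by apply: le_trans (sum_powR_le _ r0 r1) _; rewrite lerD2l ler_piMr// gerBl powR_ge0.
Qed.

(** Comparison with the harmonic series: [1 / (i + 1) <= K / (K + i)], since
    [K + i <= K (i + 1)]. *)
Lemma harmonic_unbounded (a : R) K (B : R) : 0 < a -> (0 < K)%N ->
  exists n, B < \sum_(0 <= i < n) a / (K + i)%:R.
Proof.
move=> a0 K0; apply: contrapT => /forallNP Bn.
apply: (@dvg_harmonic R); apply: nondecreasing_is_cvgn.
  by apply/nondecreasing_seqP => n; rewrite /series/= big_nat_recr//= lerDl.
exists (B * (K%:R / a)) => _ [n _ <-].
have /negP := Bn n; rewrite -leNgt => {}Bn.
apply: le_trans (ler_wpM2r _ Bn); last by rewrite divr_ge0// ltW.
rewrite /series/= mulr_suml; apply: ler_sum => i _.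
have K0' : 0 < K%:R :> R by rewrite ltr0n.
have Ki : 0 < (K + i)%:R :> R by rewrite ltr0n addn_gt0 K0.
have -> : a / (K + i)%:R * (K%:R / a) = K%:R / (K + i)%:R.
  by rewrite mulrC -mulrA [a^-1 * _]mulrA mulVf ?gt_eqF// mul1r.
rewrite ler_pdivlMr// mulrC ler_pdivrMr// -natrM ler_nat mulnS leq_add2l.
by rewrite leq_pmull.
Qed.

(** A deterministic form of the Robbins-Siegmund argument. Subtracting the partial sums of [s] from
    [z] leaves a nonincreasing sequence bounded below; and if [g] stayed above some [t > 0], the
    divergence of the sum of [e] would push [z] below [m]. *)
Lemma almost_supermartingale (z e g s : nat -> R) (m M : R) :
  (forall n, 0 <= e n) -> (forall n, 0 <= g n) -> (forall n, 0 <= s n) ->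
  (forall n, m <= z n) ->
  (forall n, z n.+1 <= z n - e n * g n + s n) ->
  (forall n, \sum_(0 <= i < n) s i <= M) ->
  (forall B, exists n, B < \sum_(0 <= i < n) e i) ->
  cvgn z /\ forall t k, 0 < t -> exists2 n, (k <= n)%N & g n < t.
Proof.
move=> e0 g0 s0 mz zS sM eoo.
have cat (f : nat -> R) k n :
    \sum_(0 <= i < k + n) f i = \sum_(0 <= i < k) f i + \sum_(k <= i < k + n) f i.
  by rewrite -big_cat_nat// leq_addr.
have zk k n : z (k + n)%N + \sum_(k <= i < k + n) e i * g i <=
    z k + \sum_(k <= i < k + n) s i.
  elim: n => [|n IH]; first by rewrite addn0 !big_geq.
  rewrite addnS !big_nat_recr ?leq_addr//=.
  have := zS (k + n)%N; lra.
have sM' k n : \sum_(k <= i < k + n) s i <= M.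
  apply: le_trans (sM (k + n)%N); rewrite cat.
  by rewrite lerDr sumr_ge0.
split; last first.
  move=> t k t0; apply: contrapT => H.
  have gt n : (k <= n)%N -> t <= g n.
    by move=> kn; rewrite leNgt; apply/negP => gnt; apply: H; exists n.
  (* The index is such that the weights beyond [k] sum to more than [(z k + M - m) / t], where
     [z k + M - m] is the largest possible decrease. *)
  have [n] := eoo (\sum_(0 <= i < k) e i + (z k + M - m) / t).
  move=> Hn.
  have : \sum_(0 <= i < n) e i <= \sum_(0 <= i < k + n) e i.
    by rewrite addnC cat lerDl sumr_ge0.
  rewrite cat => Hn2.
  have := lt_le_trans Hn Hn2; rewrite ltrD2l ltr_pdivrMr// => Hn3.
  have : (\sum_(k <= i < k + n) e i) * t <= \sum_(k <= i < k + n) e i * g i.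
    rewrite mulr_suml; apply: ler_sum_nat => i /andP[ki _].
    by rewrite ler_wpM2l// gt.
  have := zk k n; have := sM' k n; have := mz (k + n)%N; lra.
pose S n := \sum_(0 <= i < n) s i.
have cS : cvgn S.
  apply: nondecreasing_is_cvgn.
    by apply/nondecreasing_seqP => n; rewrite /S big_nat_recr//= lerDl.
  by exists M => _ [n _ <-]; exact: sM.
have cD : cvgn (z \- S).
  apply: nonincreasing_is_cvgn.
    apply/nonincreasing_seqP => n /=; rewrite /S big_nat_recr//=.
    have := zS n; have := mulr_ge0 (e0 n) (g0 n); lra.
  by exists (m - M) => _ [n _ <-]; exact: lerB (mz n) (sM n).
have -> : z = (z \- S) \+ S by apply/funext => n /=; rewrite subrK.
exact: is_cvgD.
Qed.

End real_sequences.

(** * Descent on a product of simplices *)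

Section simplices.
Context {R : realType} {m : nat} {n : 'I_m -> nat}.
Local Notation N := (\sum_i n i)%N.
Implicit Types p q : 'rV[R]_N.

Lemma simplices_convex p q (t : R) : 0 <= t -> t <= 1 ->
  simplices p -> simplices q -> simplices ((1 - t) *: p + t *: q).
Proof.
move=> t0 t1 Sp Sq i; have [p0 p1] := Sp i; have [q0 q1] := Sq i.
split=> [j|].
  have := p0 j; have := q0 j; rewrite !mxE => a b.
  by rewrite addr_ge0// mulr_ge0// subr_ge0.
transitivity (\sum_j ((1 - t) * submxrow p i 0 j + t * submxrow q i 0 j)).
  by apply: eq_bigr => j _; rewrite !mxE.
by rewrite big_split/= -!mulr_sumr p1 q1; lra.
Qed.

Lemma sum_submxrow p : \sum_x p 0 x = \sum_i \sum_j submxrow p i 0 j.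
Proof.
rewrite sig_big_dep/= (reindex _ tagnat.rank_bij_on)/=.
by apply: eq_bigr => -[i j] _; rewrite mxE.
Qed.

Lemma simplices_sum p : simplices p -> \sum_x p 0 x = m%:R.
Proof.
move=> Sp; rewrite sum_submxrow (eq_bigr (fun=> 1)).
  by rewrite sumr_const card_ord.
by move=> i _; have [] := Sp i.
Qed.

Lemma simplices_ge0 p x : simplices p -> 0 <= p 0 x.
Proof.
move=> Sp; have [p0 _] := Sp (tagnat.sig1 x).
have := p0 (tagnat.sig2 x); by rewrite mxE tagnat.sig2K.
Qed.

Lemma simplices_le1 p x : simplices p -> p 0 x <= 1.
Proof.
move=> Sp; have [p0 p1] := Sp (tagnat.sig1 x).
rewrite -p1 (bigD1 (tagnat.sig2 x))//= mxE tagnat.sig2K lerDl.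
by rewrite sumr_ge0// => j _; exact: p0.
Qed.
End simplices.

Section norms.
Context {R : realType} {N : nat}.
Implicit Types u v : 'rV[R]_N.

(* Bounds v up to a multiple of the all-ones vector, which it ignores. *)
Definition sqr_spread (x0 : 'I_N) v : R := \sum_x (v 0 x - v 0 x0) ^+ 2.

Lemma enorm_ge0 v : 0 <= enorm v. Proof. exact: sqrtr_ge0. Qed.

Lemma sqr_enorm v : enorm v ^+ 2 = \sum_x v 0 x ^+ 2.
Proof. by rewrite sqr_sqrtr// sumr_ge0// => x _; exact: sqr_ge0. Qed.

Lemma entry_le_enorm v x : `|v 0 x| <= enorm v.
Proof.
rewrite -sqrtr_sqr ler_wsqrtr// (bigD1 x)//= lerDl sumr_ge0// => y _.
exact: sqr_ge0.
Qed.

Lemma enormZ a v : enorm (a *: v) = `|a| * enorm v.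
Proof.
rewrite -sqrtr_sqr -sqrtrM ?sqr_ge0//; congr Num.sqrt.
by rewrite mulr_sumr; apply: eq_bigr => x _; rewrite mxE exprMn.
Qed.

Lemma enorm_le v (c : R) : 0 <= c -> (forall x, `|v 0 x| <= c) -> enorm v <= N%:R * c.
Proof.
move=> c0 vc.
rewrite -(@ger0_norm _ (N%:R * c)) ?mulr_ge0// -sqrtr_sqr ler_wsqrtr//.
apply: (@le_trans _ _ (\sum_(x < N) c ^+ 2)).
  by apply: ler_sum => x _; rewrite -real_normK ?num_real// lerXn2r ?nnegrE.
rewrite sumr_const card_ord exprMn -[leLHS]mulr_natl ler_wpM2r ?sqr_ge0//.
by rewrite expr2 -natrM ler_nat; case: (N) => // k; exact: leq_pmull.
Qed.

Lemma dot_le u v (c : R) : (forall x, `|v 0 x| <= c) -> `|dot u v| <= N%:R * (enorm u * c).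
Proof.
move=> vc; apply: le_trans (ler_norm_sum _ _ _) _.
apply: (@le_trans _ _ (\sum_(x < N) enorm u * c)).
  by apply: ler_sum => x _; rewrite normrM ler_pM// entry_le_enorm.
by rewrite sumr_const card_ord -[leLHS]mulr_natl.
Qed.

Lemma sqr_spread_ge0 x0 v : 0 <= sqr_spread x0 v.
Proof. by apply: sumr_ge0 => x _; exact: sqr_ge0. Qed.

(** The constant [e] cancels in differences of entries. Two uses of [(s + t)^2 <= 2 (s^2 + t^2)]
    separate the entries at [x] from those at [x0]; the latter, bounded by the norms, are counted
    [N] times. *)
Lemma sqr_spread_le x0 u v (e : R) :
  sqr_spread x0 (u + (v + const_mx e)) <=
  4 * (1 + N%:R) * (enorm u ^+ 2 + enorm v ^+ 2).
Proof.
have le2 (s t : R) : (s + t) ^+ 2 <= 2 * (s ^+ 2 + t ^+ 2).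
  by rewrite -subr_ge0 (_ : _ - _ = (s - t) ^+ 2) ?sqr_ge0//; ring.
have le4 (s t s' t' : R) : (s + t - (s' + t')) ^+ 2 <=
    4 * (s ^+ 2 + t ^+ 2) + 4 * (s' ^+ 2 + t' ^+ 2).
  have := le2 (s + t) (- (s' + t')); have := le2 s t; have := le2 s' t'.
  by rewrite sqrrN; lra.
have ule : u 0 x0 ^+ 2 <= enorm u ^+ 2.
  by rewrite sqr_enorm (bigD1 x0)//= lerDl sumr_ge0// => x _; exact: sqr_ge0.
have vle : v 0 x0 ^+ 2 <= enorm v ^+ 2.
  by rewrite sqr_enorm (bigD1 x0)//= lerDl sumr_ge0// => x _; exact: sqr_ge0.
apply: (@le_trans _ _ (\sum_(x < N) (4 * (u 0 x ^+ 2 + v 0 x ^+ 2) +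
    4 * (enorm u ^+ 2 + enorm v ^+ 2)))).
  apply: ler_sum => x _; rewrite !mxE.
  rewrite (_ : _ - _ = u 0 x + v 0 x - (u 0 x0 + v 0 x0)); last by ring.
  by apply: le_trans (le4 _ _ _ _) _; rewrite lerD2l ler_pM2l// lerD.
rewrite big_split/= sumr_const card_ord -mulr_sumr big_split/= -!sqr_enorm.
by rewrite -[_ *+ N]mulr_natl le_eqVlt; apply/orP; left; apply/eqP; ring.
Qed.

Lemma dotDr u v w : dot u (v + w) = dot u v + dot u w.
Proof. by rewrite /dot -big_split; apply: eq_bigr => x _; rewrite mxE mulrDr. Qed.

Lemma dotZr u v a : dot u (a *: v) = a * dot u v.
Proof. by rewrite /dot mulr_sumr; apply: eq_bigr => x _; rewrite mxE mulrCA. Qed.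

Lemma dotBl u v w : dot (u - v) w = dot u w - dot v w.
Proof.
by rewrite /dot -sumrB; apply: eq_bigr => x _; rewrite !mxE mulrDl mulNr.
Qed.
End norms.

(** * Descent inequality along a segment *)

Section descent.
Context {R : realType} {m : nat} {n : 'I_m -> nat}.
Local Notation N := (\sum_i n i)%N.
Variables (Z : 'rV[R]_N -> R) (L0 L1 L2 : R).
Hypothesis smoothZ : smooth_objective Z L0 L1 L2.

(** The first-order expansion of [Z] at [p + t *: v], read at [p + (t + h) *: v]. Feasibility is
    asked for both signs of [h], so this serves the interior of a segment. *)
Lemma segment_derive p v (t : R) : 
  (\forall h \near (0:R), simplices (p + (t + h) *: v)) ->
  is_derive t 1 (fun s => Z (p + s *: v)) (dot (grad Z (p + t *: v)) v).
Proof.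
move=> Sh.
have St : simplices (p + t *: v).
  by have := nbhs_singleton Sh; rewrite addr0.
suff H : h^-1 *: (Z (p + (h *: 1 + t) *: v) - Z (p + t *: v)) @[h --> 0^'] -->
    dot (grad Z (p + t *: v)) v.
  apply: DeriveDef; first by apply/cvg_ex; eexists; exact: H.
  exact/cvg_lim.
apply/cvgrPdist_le => e e0.
(* Adding 1 keeps the tolerance positive when [v = 0]. *)
have ev : 0 < e / (enorm v + 1) by rewrite divr_gt0// ltr_wpDl// enorm_ge0.
have [r r0 Zr] := C2_expansion (objective_C2 smoothZ) St ev.
near=> h.
have h0 : h != 0 by near: h; exact: nbhs_dnbhs_neq.
have Sth : simplices (p + (t + h) *: v) by near: h; exact: (@nbhs_dnbhs _ (0:R)).
have hv : enorm (h *: v) < r.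
  rewrite enormZ; apply: (@le_lt_trans _ _ (`|h| * (enorm v + 1))).
    by rewrite ler_wpM2l// lerDl.
  rewrite -ltr_pdivlMr ?ltr_wpDl ?enorm_ge0//.
  by near: h; apply: dnbhs0_lt; rewrite divr_gt0// ltr_wpDl// enorm_ge0.
have := Zr _ Sth.
have -> : p + (t + h) *: v - (p + t *: v) = h *: v.
  by rewrite scalerDl; apply/rowP => i; rewrite !mxE; ring.
move=> /(_ hv).
rewrite dotZr enormZ [h *: 1]mulr1 [h + t]addrC => H.
rewrite distrC -(ler_pM2l (_ : 0 < `|h|)) ?normr_gt0//.
rewrite -normrM mulrBr [h * (_ *: _)]mulrA divff// mul1r.
apply: le_trans H _.
rewrite mulrCA ler_pM2l ?normr_gt0// -mulrA ger_pMr// ler_pdivrMl ?ltr_wpDl ?enorm_ge0//.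
by rewrite mulr1 lerDl.
Unshelve. all: by end_near. Qed.

(** Supplies the continuity up to the endpoints that the mean value theorem asks for, where
    [segment_derive] need not apply. *)
Lemma segment_continuous (p v : 'rV[R]_N) :
  (forall t, 0 <= t -> t <= 1 -> simplices (p + t *: v)) ->
  {within `[0, 1], continuous (fun t : R => Z (p + t *: v))}.
Proof.
move=> Sv; apply/subspace_continuousP => t /= /itvP t01.
apply/cvgrPdist_le => e e0.
have c0 : 0 < `|L0| * enorm v + 1 by rewrite ltr_wpDl// mulr_ge0// enorm_ge0.
near=> s.
have s01 : s \in `[0, 1] by near: s; apply: withinT.
have st : `|t - s| < e / (`|L0| * enorm v + 1).
  near: s; apply: cvg_within; apply/nbhs_ballP.
  by exists (e / (`|L0| * enorm v + 1)) => //=; exact: divr_gt0.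
have := objective_lipschitz smoothZ (Sv t _ _) (Sv s _ _).
rewrite !t01 !(itvP s01) => /(_ isT isT isT isT) /le_trans; apply.
have -> : p + t *: v - (p + s *: v) = (t - s) *: v.
  by rewrite scalerBl; apply/rowP => i; rewrite !mxE; ring.
rewrite enormZ; apply: (@le_trans _ _ (`|L0| * (`|t - s| * enorm v))).
  by rewrite ler_wpM2r ?ler_norm// mulr_ge0// enorm_ge0.
rewrite mulrCA; apply: (@le_trans _ _ (`|t - s| * (`|L0| * enorm v + 1))).
  by rewrite ler_wpM2l// lerDl.
by rewrite -ler_pdivlMr// ltW.
Unshelve. all: by end_near. Qed.

(** By the mean value theorem [Z q - Z p] is a derivative at an intermediate point; moving its
    gradient back to [p] costs at most [|L1| N c] in norm. The absolute value spares a sign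
    assumption on [L1]. *)
Lemma descent p q (c : R) : simplices p -> simplices q -> 0 <= c ->
  (forall x, `|(q - p) 0 x| <= c) ->
  Z q <= Z p + dot (grad Z p) (q - p) + N%:R * (`|L1| * (N%:R * c) * c).
Proof.
move=> Sp Sq c0 qpc; set v := q - p.
have Sv t : 0 <= t -> t <= 1 -> simplices (p + t *: v).
  move=> t0 t1; have -> : p + t *: v = (1 - t) *: p + t *: q.
    by apply/rowP => i; rewrite !mxE; ring.
  exact: simplices_convex.
have dZ (t : R) : t \in `]0, 1[%R ->
    is_derive t 1 (fun s => Z (p + s *: v)) (dot (grad Z (p + t *: v)) v).
  move=> /itvP t01; apply: segment_derive.
  (* This radius keeps [t + h] inside [[0, 1]]. *)
  have t0 : 0 < Num.min t (1 - t) by rewrite lt_min subr_gt0 !t01.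
  apply/nbhs_ballP; exists (Num.min t (1 - t)) => //= h.
  rewrite /ball/= sub0r normrN lt_min !ltr_norml => /andP[/andP[h1 h2] /andP[h3 h4]].
  by apply: Sv; lra.
have [t /itvP t01 H] := MVT ltr01 dZ (segment_continuous Sv).
move: H; rewrite scale1r scale0r addr0 subr0 mulr1 (subrKC p q) => H.
suff : dot (grad Z (p + t *: v)) v - dot (grad Z p) v <=
    N%:R * (`|L1| * (N%:R * c) * c) by move: H; lra.
rewrite -dotBl; apply: le_trans (ler_norm _) _; apply: le_trans (dot_le _ qpc) _.
rewrite ler_wpM2l// ler_wpM2r//.
apply: le_trans (gradient_lipschitz smoothZ (Sv t _ _) Sp) _; rewrite ?t01//.
apply: (@le_trans _ _ (`|L1| * enorm (p + t *: v - p))).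
  by rewrite ler_wpM2r ?ler_norm// enorm_ge0.
rewrite ler_wpM2l//.
have -> : p + t *: v - p = t *: v by rewrite addrC addKr.
rewrite enormZ ger0_norm ?t01//; apply: le_trans (ler_piMl _ _) _; rewrite ?enorm_ge0 ?t01//.
exact: enorm_le.
Unshelve. all: by end_near. Qed.

End descent.

(** * The deterministic limit *)

Section topology.
Context {R : realType}.

(** Near the cluster point [x] there are terms [u k] at which [f] is within [e / 2] of both [l] and
    [f x]. *)
Lemma cluster_value (T : topologicalType) (D : set T) (f : T -> R)
    (u : nat -> T) (l : R) (x : T) :
  {within D, continuous f} -> (forall k, D (u k)) -> D x ->
  cluster (u @ \oo) x -> f (u k) @[k --> \oo] --> l -> f x = l.
Proof.
move=> cf Du Dx clx ful.
apply/eqP; rewrite -subr_eq0 -normr_le0; apply/ler_addgt0Pl => e e0; rewrite addr0.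
have e2 : 0 < e / 2 by rewrite divr_gt0.
have /subspace_continuousP /(_ x Dx) /cvgrPdist_lt /(_ _ e2) := cf.
rewrite near_withinE => V.
have W : (u @ \oo) [set y | D y /\ `|l - f y| < e / 2].
  have /cvgrPdist_lt /(_ _ e2) := ful.
  by apply: filterS => k /= ?; split.
have [y [[Dy ly] Vy]] := clx _ _ W V.
have := Vy Dy; move: ly.
have -> : f x - l = (f x - f y) - (l - f y) by ring.
move=> h1 h2; apply: le_trans (ler_normB _ _) _.
by rewrite [leRHS](splitr e) lerD// ltW.
Qed.
End topology.

Lemma compact_cube {R : realType} N (a b : R) :
  compact [set v : 'rV[R]_N | forall x, v ord0 x \in `[a, b]].
Proof.
apply: (@rV_compact _ _ (fun=> `[a, b]%classic)) => _; exact: segment_compact.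
Qed.

Section feasible.
Context {R : realType} {m : nat} {n : 'I_m -> nat}.
Local Notation N := (\sum_i n i)%N.

Lemma closed_prod_set (U : forall i : 'I_m, set 'rV[R]_(n i)) :
  (forall i, closed (U i)) -> closed (prod_set U).
Proof.
move=> cU.
have -> : prod_set U = \bigcap_(i in setT) ((fun p : 'rV[R]_N => submxrow p i) @^-1` U i).
  by apply/seteqP; split => p Up i => [_|]; exact: (Up i).
apply: closed_bigI => i _; apply: preimage_closed (cU i) => p _.
move=> A [P nP PA].
(* Entry [x] inherits the neighbourhood [P i' j] when it is entry [j] of block [i], and is left free
   otherwise; injectivity of the ranking makes such a [j] unique. *)
exists (fun i' x => [set y | forall j, tagnat.Rank i j = x -> P i' j y]).
  move=> i' x; have [[j jx]|nj] := pselect (exists j, tagnat.Rank i j = x).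
    have := nP i' j; rewrite mxE -jx; apply: filterS => y Py k.
    rewrite /tagnat.Rank => /tagnat.rank_inj /eqP; rewrite eq_Tagged => /eqP/= kj.
    by rewrite kj.
  by apply: filterE => y j jx; exfalso; apply: nj; exists j.
move=> q Pq; apply: PA => i' j; rewrite mxE; exact: Pq.
Qed.

Lemma compact_prod_set (U : forall i : 'I_m, set 'rV[R]_(n i)) :
  (forall i, closed (U i)) -> prod_set U `<=` simplices ->
  compact (prod_set U).
Proof.
move=> cU US; apply: (subclosed_compact (closed_prod_set cU) (@compact_cube R N 0 1)).
move=> p Up x /=; have Sp := US _ Up.
by rewrite in_itv/= simplices_ge0// simplices_le1.
Qed.

End feasible.

(** * One Frank-Wolfe step with an inexact gradient *)

Section frank_wolfe.
Context {R : realType} {m : nat} {n : 'I_m -> nat}.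
Local Notation N := (\sum_i n i)%N.
Variables (Z : 'rV[R]_N -> R) (L0 L1 L2 : R) (S : set 'rV[R]_N).
Hypothesis smoothZ : smooth_objective Z L0 L1 L2.
Hypothesis Ssub : S `<=` simplices.
Hypothesis gapZ : regular_gap Z S.

Lemma gap_argmin p q : linear_argmin S (grad Z p) p q ->
  FW_gap Z S p = - dot (grad Z p) (q - p).
Proof.
move=> [Sq qmin]; congr (- _); apply/eqP; rewrite eq_le; apply/andP; split.
  apply: ge_inf; last by exists q.
  by exists (dot (grad Z p) (q - p)) => _ [r Sr <-]; exact: qmin.
apply: lb_le_inf; first by exists (dot (grad Z p) (q - p)), q.
by move=> _ [r Sr <-]; exact: qmin.
Qed.

Lemma gap_ge0 p : S p -> 0 <= FW_gap Z S p.
Proof.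
move=> Sp; have [q qmin] := gap_attained gapZ (Ssub Sp).
rewrite (gap_argmin qmin) oppr_ge0; apply: le_trans (qmin.2 _ Sp) _.
by rewrite /dot big1// => x _; rewrite !mxE subrr mulr0.
Qed.

(* Differences of feasible points have entries summing to 0, so adding a
   multiple of the all-ones vector to d does not change the scalar product. *)
Lemma dot_feasible_le (d p q : 'rV[R]_N) x0 (t : R) : 0 < t ->
  simplices p -> simplices q ->
  dot d (q - p) <= N%:R * t + t^-1 * sqr_spread x0 d.
Proof.
move=> t0 Sp Sq.
have -> : dot d (q - p) = \sum_x (d 0 x - d 0 x0) * (q - p) 0 x.
  rewrite (eq_bigr (fun x => d 0 x * (q - p) 0 x - d 0 x0 * (q - p) 0 x)); last first.
    by move=> x _; rewrite mulrBl.
  rewrite sumrB -mulr_sumr.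
  rewrite [X in _ * X](_ : _ = 0) ?mulr0 ?subr0//.
  transitivity (\sum_x (q 0 x - p 0 x)); first by apply: eq_bigr => x _; rewrite !mxE.
  by rewrite sumrB !simplices_sum// subrr.
(* The entries of [q - p] have absolute value at most 1, and [|y| <= t + y^2 / t]. *)
apply: (@le_trans _ _ (\sum_(x < N) (t + t^-1 * (d 0 x - d 0 x0) ^+ 2))); last first.
  by rewrite big_split/= sumr_const card_ord -mulr_sumr lerD2r -[leLHS]mulr_natl.
apply: ler_sum => x _; set y := d 0 x - d 0 x0.
apply: le_trans (ler_norm _) _; rewrite normrM.
apply: (@le_trans _ _ `|y|).
  rewrite ler_piMr// !mxE ler_norml.
  have := simplices_ge0 x Sp; have := simplices_ge0 x Sq.
  have := simplices_le1 x Sp; have := simplices_le1 x Sq; lra.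
rewrite -(ler_pM2l t0) mulrDr mulVKf ?gt_eqF// -(real_normK (num_real y)).
by nra.
Qed.

(** Let [q] be optimal for the true gradient. As [qh] is optimal for [v], it loses at most
    [dot (v - grad Z p) (q - qh)] against [q]; this pairs the error with a difference of feasible
    points, so [dot_feasible_le] applies. The last term is the curvature along a displacement with
    entries at most [eps]. *)
Lemma FW_descent_step (v p qh : 'rV[R]_N) x0 (eps t : R) :
  0 < t -> 0 <= eps -> eps <= 1 -> S p -> linear_argmin S v p qh ->
  Z ((1 - eps) *: p + eps *: qh) <= Z p - eps * FW_gap Z S p +
    (eps * (N%:R * t + t^-1 * sqr_spread x0 (v - grad Z p))
     + N%:R * (`|L1| * (N%:R * eps) * eps)).
Proof.
move=> t0 e0 e1 Sp [Sqh qhmin].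
have Sp' := Ssub Sp; have Sqh' := Ssub Sqh.
have [q qmin] := gap_attained gapZ Sp'.
have Sq := qmin.1; have Sq' := Ssub Sq.
rewrite (gap_argmin qmin).
have E : (1 - eps) *: p + eps *: qh - p = eps *: (qh - p).
  by apply/rowP => i; rewrite !mxE; ring.
have := @descent _ _ _ _ _ _ _ smoothZ p ((1 - eps) *: p + eps *: qh) eps Sp'
  (simplices_convex e0 e1 Sp' Sqh') e0.
rewrite E dotZr => /(_ _)/le_trans; apply.
  move=> x; rewrite !mxE normrM ger0_norm// ler_piMr// ler_norml.
  have := simplices_ge0 x Sp'; have := simplices_ge0 x Sqh'.
  have := simplices_le1 x Sp'; have := simplices_le1 x Sqh'; lra.
have H1 := dot_feasible_le (v - grad Z p) x0 t0 Sqh' Sq'.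
have H2 := qhmin _ Sq.
have H3 : dot (grad Z p) (qh - p) <= dot (grad Z p) (q - p) + dot (v - grad Z p) (q - qh).
  have -> : dot (v - grad Z p) (q - qh) =
      dot v (q - p) - dot v (qh - p) - (dot (grad Z p) (q - p) - dot (grad Z p) (qh - p)).
    have -> : q - qh = (q - p) + -1 *: (qh - p) by apply/rowP => i; rewrite !mxE; ring.
    by rewrite dotDr dotZr !dotBl; ring.
  by lra.
rewrite mulrN opprK addrA lerD2r -addrA lerD2l -mulrDr ler_wpM2l//.
by apply: le_trans H3 _; rewrite lerD2l.
Qed.

End frank_wolfe.

(** * Limits of values and of iterates along one path *)

Section frank_wolfe_limit.
Context {R : realType} {m : nat} {n : 'I_m -> nat}.
Local Notation N := (\sum_i n i)%N.
Variables (Z : 'rV[R]_N -> R) (L0 L1 L2 : R) (S : set 'rV[R]_N).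
Hypothesis smoothZ : smooth_objective Z L0 L1 L2.
Hypothesis Ssub : S `<=` simplices.
Hypothesis gapZ : regular_gap Z S.
Hypothesis cptS : compact S.
Variable u : nat -> 'rV[R]_N.
Hypothesis Su : forall k, S (u k).

Lemma FW_values_cvg (e s : nat -> R) (M : R) :
  (forall k, 0 <= e k) -> (forall k, 0 <= s k) ->
  (forall k, Z (u k.+1) <= Z (u k) - e k * FW_gap Z S (u k) + s k) ->
  (forall k, \sum_(0 <= i < k) s i <= M) ->
  (forall B, exists k, B < \sum_(0 <= i < k) e i) ->
  exists q, [/\ S q, FW_gap Z S q = 0 & Z (u k) @[k --> \oo] --> Z q].
Proof.
move=> e0 s0 Zu sM eoo.
have [pm Spm pmin] := objective_attained gapZ.
have [cZ gsmall] := almost_supermartingale e0 (fun k => gap_ge0 Ssub gapZ (Su k))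
  s0 (fun k => pmin _ (Su k)) Zu sM eoo.
(* [h j] is an index beyond [j] with gap below [1 / (j + 1)]; a cluster point of [u \o h] is the
   required [q]. *)
have /choice[h hP] : forall j, exists k, (j <= k)%N /\ FW_gap Z S (u k) < j.+1%:R^-1.
  by move=> j; have [|k jk gk] := gsmall j.+1%:R^-1 j; [rewrite invr_gt0|exists k].
have hoo : h @ \oo --> \oo.
  by apply/cvgnyPge => A; exists A => // j /= Aj; apply: leq_trans Aj (hP j).1.
have Suh k : S ((u \o h) k) by exact: Su.
have SF : ((u \o h) @ \oo) S by exists 0%N => // k _; exact: Suh.
have [q [Sq qcl]] := cptS _ SF.
exists q; split => //.
  apply: (cluster_value (gap_continuous gapZ) (fun k => Ssub (Suh k)) (Ssub Sq) qcl).
  apply: (@squeeze_cvgr _ _ _ _ (fun=> 0) (@harmonic R)).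
  - apply: nearW => k /=; rewrite gap_ge0//=; exact/ltW/(hP k).2.
  - exact: cvg_cst.
  - exact: cvg_harmonic.
(* All the values converge, so their limit can be identified along [h]. *)
have -> : Z q = lim (Z (u k) @[k --> \oo]).
  apply: (cluster_value (C2_continuous (objective_C2 smoothZ))
    (fun k => Ssub (Suh k)) (Ssub Sq) qcl).
  exact: (cvg_comp _ _ hoo cZ).
exact: cZ.
Qed.

(** Every cluster point lies in [S] and has value [Z q], hence is [q]; within a compact set a unique
    cluster point is the limit. *)
Lemma minimizing_sequence_cvg q : S q ->
  (forall p, S p -> p != q -> Z q < Z p) -> Z (u k) @[k --> \oo] --> Z q ->
  u k @[k --> \oo] --> q.
Proof.
move=> Sq qmin Zuq.
have SF : (u @ \oo) S by exists 0%N => // k _; exact: Su.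
have cl y : cluster (u @ \oo) y -> y = q.
  move=> ycl.
  have Sy : S y.
    have clS : closed S by apply: compact_closed cptS; exact: norm_hausdorff.
    apply: clS => B yB.
    have [z [Sz Bz]] := ycl _ _ SF yB.
    by exists z.
  apply/eqP; apply: contraT => /(qmin _ Sy).
  rewrite (cluster_value (C2_continuous (objective_C2 smoothZ))
    (fun k => Ssub (Su k)) (Ssub Sy) ycl Zuq).
  by rewrite ltxx.
have [y [Sy ycl]] := cptS _ SF.
(* The cube [[-1, 2]^N] is a compact neighbourhood of [q], whereas [q] may lie on the boundary of
   [S]. *)
apply: (compact_cluster_set1 (V := [set v : 'rV[R]_N | forall x, v ord0 x \in `[-1, 2]])).
- exact: norm_hausdorff.
- exact: compact_cube.
- exists (fun i x => ball (q i x) 1) => [i x|v qv x]; first exact: nbhsx_ballx.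
  have := qv ord0 x; rewrite /ball/= ltr_norml in_itv/=.
  have := simplices_ge0 x (Ssub Sq); have := simplices_le1 x (Ssub Sq); lra.
- exists 0%N => // k _ x /=; rewrite in_itv/=.
  have := simplices_ge0 x (Ssub (Su k)); have := simplices_le1 x (Ssub (Su k)); lra.
- apply/seteqP; split => [z /cl -> //|z ->]; rewrite -(cl _ ycl) //.
Qed.

End frank_wolfe_limit.

Lemma dist_set_cvg0 {R : realType} (z : nat -> R) (l : R) (A : set R) :
  A l -> z k @[k --> \oo] --> l -> dist_set (z k) A @[k --> \oo] --> 0%E.
Proof.
move=> Al zl.
have nl : (`|z k - l|)%:E @[k --> \oo] --> 0%E.
  apply: cvg_EFin; first exact: nearW.
  apply/cvgrPdist_lt => e e0.
  have /cvgrPdist_lt /(_ _ e0) := zl.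
  by apply: filterS => k /=; rewrite distrC sub0r normrN normr_id.
apply: (squeeze_cvge _ (cvg_cst 0%E) nl).
apply: nearW => k; apply/andP; split.
  by apply: le_ereal_inf_tmp => _ [y _ <-]; rewrite lee_fin.
by apply: ereal_inf_lbound; exists l.
Qed.

(** * Independence and integration *)

Section product_law.
Local Open Scope ereal_scope.
Context {R : realType} d d1 d2 (Om : measurableType d) (T1 : measurableType d1)
  (T2 : measurableType d2) (P : probability Om R) (V1 : Om -> T1) (V2 : Om -> T2).
Hypothesis mV1 : measurable_fun setT V1.
Hypothesis mV2 : measurable_fun setT V2.
Hypothesis indep : forall A B, measurable A -> measurable B ->
  P (V1 @^-1` A `&` V2 @^-1` B) = P (V1 @^-1` A) * P (V2 @^-1` B).

(** Independence makes the law of [(V1, V2)] the product of the marginal laws, and Tonelli's theorem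
    integrates out [V2] first. The inner bound is asked only at values of [V1]. *)
Lemma integral_independent_le (f : T1 * T2 -> \bar R) (M : R) :
  measurable_fun [set: T1 * T2] f -> (forall z, 0 <= f z) ->
  (forall w, \int[P]_w' f (V1 w, V2 w') <= M%:E) ->
  \int[P]_w f (V1 w, V2 w) <= M%:E.
Proof.
move=> mf f0 fM.
pose mfun1 : {mfun Om >-> T1} := HB.pack V1 (isMeasurableFun.Build _ _ _ _ _ mV1).
pose mfun2 : {mfun Om >-> T2} := HB.pack V2 (isMeasurableFun.Build _ _ _ _ _ mV2).
have mV : measurable_fun setT (fun w => (V1 w, V2 w)) by exact: measurable_fun_pair.
pose mfun12 : {mfun Om >-> (T1 * T2)%type} :=
  HB.pack (fun w => (V1 w, V2 w)) (isMeasurableFun.Build _ _ _ _ _ mV).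
pose Q1 : probability T1 R := distribution P mfun1.
pose Q2 : probability T2 R := distribution P mfun2.
pose Q : probability (T1 * T2)%type R := distribution P mfun12.
have QE X : measurable X -> (Q1 \x Q2) X = Q X.
  apply: product_measure_unique => A B mA mB.
  by rewrite /Q /Q1 /Q2 /distribution /pushforward /= -indep.
have M0 : 0 <= M%:E.
  by apply: le_trans (fM point); exact: integral_ge0.
rewrite -[leLHS]/(\int[P]_(w in (fun w => (V1 w, V2 w)) @^-1` setT)
  (f \o (fun w => (V1 w, V2 w))) w).
rewrite -ge0_integral_pushforward//.
rewrite (_ : integral _ _ _ = \int[Q]_(z in setT) f z)//.
have -> : \int[Q]_z f z = \int[Q1 \x Q2]_z f z.
  by apply: eq_measure_integral => A mA _; apply/esym/QE.
rewrite fubini_tonelli1//.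
have mF : measurable_fun setT (fubini_F Q2 f) by exact: measurable_fun_fubini_tonelli_F.
have F0 x : 0 <= fubini_F Q2 f x by apply: integral_ge0.
rewrite /Q1 /distribution ge0_integral_pushforward// preimage_setT.
apply: (@le_trans _ _ (\int[P]_(x in setT) M%:E)); last first.
  by have := expectation_cst P M; rewrite unlock => ->.
apply: (@ge0_le_integral _ _ _ P setT measurableT
  (fun x => fubini_F Q2 f (V1 x)) (fun=> M%:E)) => //.
- exact: (measurableT_comp mF mV1).
- move=> w _; rewrite /fubini_F /Q2 /distribution ge0_integral_pushforward//.
    by rewrite preimage_setT; exact: fM.
  exact: (measurableT_comp mf (pair1_measurable _ )).
Qed.
End product_law.

(** * From independent events to independent sigma-algebras *)

Section sigma_independence.
Local Open Scope ereal_scope.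
Context {R : realType} d (Om : measurableType d) (P : probability Om R).

(** For fixed [A], the finite measures sending [B] to the probability of its intersection with [A]
    and to [P A * P B] agree on the pi-system [G], hence on the sigma-algebra it generates. *)
Lemma independent_g_sigma (H G : set_system Om) :
  H `<=` measurable -> G `<=` measurable -> setI_closed G -> G setT ->
  (forall A B, H A -> G B -> P (A `&` B) = P A * P B) ->
  forall A B, H A -> <<s G >> B -> P (A `&` B) = P A * P B.
Proof.
move=> mH mG GI GT HG A B HA sB.
have mA := mH _ HA.
have PA0 : 0 <= P A by exact: measure_ge0.
have PAfin : P A \is a fin_num by exact: fin_num_measure.
pose r : {nonneg R} := NngNum (fine_ge0 PA0).
have rE : (r%:num)%:E = P A by rewrite /= fineK.
pose m1 := mrestr P mA; pose m2 := mscale r P.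
have := @g_sigma_algebra_measure_unique _ R Om G mG (fun=> setT) (fun=> GT) _ m1 m2 GI.
rewrite bigcup_const; last by exists 0%N.
move=> /(_ erefl) => U.
have m1E C : m1 C = P (A `&` C) by rewrite setIC.
have m2E C : m2 C = P A * P C by rewrite -rE.
rewrite -m1E -m2E; apply: U sB => [C GC|_].
  by apply: (etrans (m1E C)); apply: (etrans _ (esym (m2E C))); rewrite HG.
have m1T : m1 setT = P A := etrans (m1E setT) (congr1 P (setIT A)).
by apply: (le_lt_trans (_ : _ <= P A)); [rewrite -[leRHS]m1T|rewrite -ge0_fin_numE].
Qed.

(** Mutual independence speaks of finitely many events at a time. Finite intersections of events
    from the sources [Some i] form a pi-system [K] whose sigma-algebra contains [B], so it suffices
    to treat [K]. *)
Lemma independent_sources (I : choiceType) (past : set_system Om)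
    (G : option I -> set_system Om) :
  G None = past -> (forall i, G i `<=` measurable) ->
  (forall i A B, G i A -> G i B -> G i (A `&` B)) ->
  (forall i, G i setT) ->
  mutually_independent P G ->
  forall A B, past A -> <<s \bigcup_i G (Some i) >> B -> P (A `&` B) = P A * P B.
Proof.
move=> GN mG GI GT ind.
pose K : set_system Om := [set B | exists (J : {fset I}) (C : I -> set Om),
  (forall i, G (Some i) (C i)) /\ B = \bigcap_(i in [set` J]) C i].
have KI : setI_closed K.
  move=> _ _ [J1 [C1 [GC1 ->]]] [J2 [C2 [GC2 ->]]].
  exists (J1 `|` J2)%fset.
  (* Padding with the whole space gives both families the index set of the union. *)
  pose C12 i := (if i \in J1 then C1 i else setT) `&` (if i \in J2 then C2 i else setT).
  exists C12; split.
    by move=> i; apply: GI; case: ifP.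
  apply/seteqP; split => w.
    move=> [w1 w2] i _; split; case: ifPn => // iJ; [exact: w1|exact: w2].
  move=> w12; split => i iJ.
    have [] := w12 i; first by rewrite /= in_fsetU (iJ : i \in J1).
    by rewrite (iJ : i \in J1).
  have [] := w12 i; first by rewrite /= in_fsetU (iJ : i \in J2) orbT.
  by rewrite (iJ : i \in J2).
have KT : K setT.
  exists fset0, (fun=> setT); split => //.
  by apply/seteqP; split => // w _ i.
have KG i : G (Some i) `<=` K.
  move=> B GB; exists [fset i]%fset, (fun j => if j == i then B else setT).
  split; first by move=> j; case: eqP => [->|].
  apply/seteqP; split => w.
    by move=> Bw j /=; rewrite inE => /eqP ->; rewrite eqxx.
  by move=> /(_ i); rewrite /= inE eqxx; exact.
have mK : K `<=` measurable.
  move=> _ [J [C [GC ->]]]; apply: fin_bigcap_measurable => // i _.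
  exact: mG (GC i).
have mpast : past `<=` measurable by rewrite -GN; exact: mG.
move=> A B pA sB.
have sKB : <<s K >> B.
  move: sB; apply: smallest_sub; first exact: smallest_sigma_algebra.
  by move=> C [i _ /KG]; exact: sub_sigma_algebra.
apply: (@independent_g_sigma past K) => // {B pA sB sKB}{}A _ pA [J [C [GC ->]]].
pose D (s : option I) := if s is Some i then C i else A.
have GD s : G s (D s) by case: s => //=; rewrite GN.
(* Mutual independence is applied with and without the index [None]; the two products differ by the
   factor [P A]. *)
have := ind (None |` [fset Some i | i in J])%fset D (fun s _ => GD s).
rewrite big_fsetU1/=; last by apply/imfsetP => -[].
have := ind [fset Some i | i in J]%fset D (fun s _ => GD s).
move=> <-.
have E : \bigcap_(i in [set` [fset Some i | i in J]%fset]) D i =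
   \bigcap_(i in [set` J]) C i.
  apply/seteqP; split => w Dw i /=.
    by move=> iJ; apply: (Dw (Some i)); apply/imfsetP; exists i.
  by move=> /imfsetP[j /= jJ ->]; exact: Dw.
rewrite E => <-; congr (P _).
apply/seteqP; split => w.
  move=> [Aw Cw] s /=; rewrite in_fset1U => /orP[/eqP->//|sJ].
  by have : (\bigcap_(i in [set` [fset Some i | i in J]%fset]) D i) w;
    [rewrite E; exact: Cw | exact].
move=> Dw; split; first by apply: (Dw None); rewrite /= in_fset1U eqxx.
rewrite -E => s sJ; apply: Dw; rewrite /= in_fset1U; apply/orP; right; exact: sJ.
Qed.

End sigma_independence.

Section ae_series.
Context {R : realType} d (Om : measurableType d) (P : probability Om R).

(** By monotone convergence the sum of the series has expectation at most [B], so it is almost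
    surely finite, and it dominates its partial sums. *)
Lemma ae_series_bounded (Y : nat -> Om -> R) (B : R) :
  (forall n, measurable_fun setT (Y n)) -> (forall n w, 0 <= Y n w) ->
  (forall n, (\sum_(0 <= i < n) \int[P]_w (Y i w)%:E <= B%:E)%E) ->
  {ae P, forall w, exists M, forall n, \sum_(0 <= i < n) Y i w <= M}.
Proof.
move=> mY Y0 YB.
pose f w := (\sum_(n <oo) (Y n w)%:E)%E.
have mYE n : measurable_fun setT (fun w => (Y n w)%:E) by apply/measurable_EFinP.
have Y0E n w : (0 <= (Y n w)%:E)%E by rewrite lee_fin.
have mf : measurable_fun setT f by apply: ge0_emeasurable_sum.
have f0 w : (0 <= f w)%E by apply: nneseries_ge0.
have If : (\int[P]_w f w <= B%:E)%E.
  rewrite integral_nneseries//.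
  apply: lime_le; last by apply: nearW => n; exact: YB.
  by apply: is_cvg_nneseries => n _ _; apply: integral_ge0.
have intf : P.-integrable setT f.
  apply/integrableP; split => //.
  under eq_integral do rewrite gee0_abs//.
  by rewrite (le_lt_trans If)// ltry.
have := integrable_ae measurableT intf.
apply: filterS => w /(_ I) fw.
exists (fine (f w)) => n.
rewrite -lee_fin fineK// -sumEFin.
by apply: nneseries_lim_ge => i _.
Qed.
End ae_series.

(** * Integration over the fresh noise with the past frozen *)

Section fresh_noise.
Context {R : realType} {d d1 d2 : measure_display} {Om : measurableType d}
  {E : measurableType d1} {X : measurableType d2} {N : nat}.
Variables (P : probability Om R) (Qe : probability E R) (Qx : probability X R)
  (F : nat -> set_system Om) (eta : nat -> nat -> Om -> E)
  (J : nat -> nat -> Om -> 'I_N) (xi : nat -> nat -> Om -> X).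
Hypothesis fresh : fresh_sampling P Qe Qx F eta J xi.

Definition noise k : set_system Om :=
  \bigcup_i sources (F k) (eta k) (J k) (xi k) (Some i).

Lemma noise_measurable k : noise k `<=` measurable.
Proof.
move=> A [i _ iA]; have [_ mF _] := sampling_filtration fresh.
exact/mF/(sampling_revealed fresh iA).
Qed.

Lemma independent_noise k A B : F k A -> <<s noise k >> B ->
  P (A `&` B) = (P A * P B)%E.
Proof.
have [sF mF _] := sampling_filtration fresh.
apply: (@independent_sources _ _ _ P _ (F k) (sources (F k) (eta k) (J k) (xi k))) => //.
- by move=> s A' sA'; exact/mF/(sampling_revealed fresh sA').
- move=> [[[t|t]|t]|] {}A {}B.
  + by move=> [A' mA' <-] [B' mB' <-]; exists (A' `&` B') => //; exact: measurableI.
  + by move=> [A' mA' <-] [B' mB' <-]; exists (A' `&` B').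
  + by move=> [A' mA' <-] [B' mB' <-]; exists (A' `&` B') => //; exact: measurableI.
  + rewrite /sources -[F k](@sigma_algebra_id _ setT)// => FA FB.
    exact: (@measurableI _ (g_sigma_algebraType (F k))).
- move=> [[[t|t]|t]|].
  + by exists setT => //; exact: measurableT.
  + by exists setT.
  + by exists setT => //; exact: measurableT.
  + by rewrite /sources -[F k](@sigma_algebra_id _ setT)//;
      exact: (@measurableT _ (g_sigma_algebraType (F k))).
- exact: (sampling_independent fresh).
Qed.

Lemma eta_measurable k t : measurable_fun [set: Om] (eta k t).
Proof.
move=> _ B mB; rewrite setTI; apply: (@noise_measurable k).
by exists (inl (inl t)) => //; exists B.
Qed.

Lemma J_measurable k t y : measurable (J k t @^-1` [set y]).
Proof. by apply: (@noise_measurable k); exists (inl (inr t)) => //; exists [set y]. Qed.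

Lemma xi_measurable k t : measurable_fun [set: Om] (xi k t).
Proof.
move=> _ B mB; rewrite setTI; apply: (@noise_measurable k).
by exists (inr t) => //; exists B.
Qed.

(** The sample space is taken twice, with the past and with the noise as sigma-algebra; the diagonal
    then acts as a pair of independent variables. *)
Lemma diagonal_measurable k : measurable_fun [set: Om]
  (fun w => (w, w) : g_sigma_algebraType (F k) * g_sigma_algebraType (noise k)).
Proof.
have [sF mF _] := sampling_filtration fresh.
apply: measurable_fun_pair.
  move=> _ A; rewrite measurable_g_measurableTypeE// => FA.
  by rewrite setTI; apply: (mF k); exact: FA.
move=> _ A sA; rewrite setTI; move: sA; apply: smallest_sub.
  exact: sigma_algebra_measurable.
exact: noise_measurable.
Qed.

(** Under [P] the two copies of the identity are independent, so a bound valid with the past frozen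
    at each [w] survives when both copies share the sample point. This replaces conditioning on
    [F k]. *)
Lemma integral_past_noise_le k (f : Om * Om -> R) (M : R) :
  measurable_fun [set: g_sigma_algebraType (F k) * g_sigma_algebraType (noise k)] f ->
  (forall z, 0 <= f z) ->
  (forall w, (\int[P]_w' (f (w, w'))%:E <= M%:E)%E) ->
  (\int[P]_w (f (w, w))%:E <= M%:E)%E.
Proof.
move=> mf f0 fM.
have [sF mF _] := sampling_filtration fresh.
have mdiag := @diagonal_measurable k.
have mid1 := measurableT_comp measurable_fst mdiag.
have mid2 := measurableT_comp measurable_snd mdiag.
apply: (integral_independent_le mid1 mid2 _ (f := EFin \o f)) => //.
  move=> A B mA mB; apply: (@independent_noise k) => //.
  by move: mA; rewrite measurable_g_measurableTypeE.
exact/measurable_EFinP.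
Qed.

End fresh_noise.

(** * Measurability of the estimators *)

Lemma min_entry_ge {R : realType} {N : nat} (v : 'rV[R]_N) (c : R) :
  c <= 1 -> (forall x, c <= v 0 x) -> c <= min_entry v.
Proof.
move=> c1 cv; rewrite /min_entry; elim/big_rec : _ => [//|x y _ cy].
by rewrite le_min cv.
Qed.

Lemma positive_lower_bound {R : realType} {N : nat} (v : 'rV[R]_N) :
  (forall x, 0 < v 0 x) ->
  exists c, [/\ 0 < c, c <= 1 & forall x, c <= v 0 x].
Proof.
move=> v0; exists (min_entry v); split.
- by rewrite /min_entry; elim/big_rec : _ => // x y _ y0; rewrite lt_min v0.
- by rewrite /min_entry; elim/big_rec : _ => // x y _ y0; rewrite ge_min y0 orbT.
- by move=> x; rewrite /min_entry (bigD1 x)//= ge_min lexx.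
Qed.

Section row_measurability.
Context {R : realType} d {T : measurableType d} {N : nat}.
Implicit Types p q : T -> 'rV[R]_N.

Definition measurable_row p :=
  forall x, measurable_fun [set: T] (fun z => p z 0 x).

(** [f] is continuous only relative to [D], which need not be measurable. The set where [f \o p]
    exceeds [r] is a countable union of preimages of rational boxes on whose trace on [D] the
    function exceeds [r]. *)
Lemma measurable_continuous_within (D : set 'rV[R]_N) (f : 'rV[R]_N -> R) p :
  {within D, continuous f} -> (forall z, D (p z)) -> measurable_row p ->
  measurable_fun [set: T] (f \o p).
Proof.
move=> cf Dp mp.
apply: (measurability _ (RGenOInfty.measurableE R)) => _ [_ [r ->] <-]; rewrite setTI.
pose box (ck : 'rV[rat]_N * nat) : set 'rV[R]_N :=
  [set v | forall x, `|v 0 x - ratr (ck.1 0 x)| < ck.2.+1%:R^-1].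
pose good ck := forall v, D v -> box ck v -> r < f v.
pose A k := if @choice.unpickle ('rV[rat]_N * nat)%type k is Some ck then
  [set z | good ck /\ box ck (p z)] else set0.
rewrite (_ : _ @^-1` _ = \bigcup_k A k).
  apply: bigcupT_measurable => k; rewrite /A.
  case: choice.unpickle => [ck|]; last exact: measurable0.
  have [gck|ngck] := pselect (good ck); last first.
    rewrite (_ : [set _ | _] = set0); first exact: measurable0.
    by apply/seteqP; split => // z [].
  rewrite (_ : [set _ | _] = \bigcap_(x in [set: 'I_N])
      (fun z => p z 0 x) @^-1` ball (ratr (ck.1 0 x) : R) (ck.2.+1%:R^-1)).
    apply: fin_bigcap_measurable => // x _; rewrite -[X in measurable X]setTI.
    by apply: mp => //; exact: measurable_ball.
  apply/seteqP; split => z; first by move=> [_ H] x _; rewrite /ball/= distrC; exact: H.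
  by move=> H; split => // x; rewrite distrC; exact: (H x).
apply/seteqP; split => z /=; rewrite in_itv/= andbT; last first.
  move=> [k _]; rewrite /A; case: choice.unpickle => // ck [gck]; apply: gck; exact: Dp.
move=> rfz.
have /subspace_continuousP /(_ (p z) (Dp z)) := cf.
have e0 : 0 < f (p z) - r by rewrite subr_gt0.
move=> /cvgrPdist_lt /(_ _ e0); rewrite near_withinE => /nbhs_ballP[e e_gt0 He].
(* A box of this half-width containing [p z] stays within [e] of it: both distances to the centre
   are below [e / 2]. *)
have [k ke] : exists k, k.+1%:R^-1 < e / 2 :> R.
  exists (Num.truncn (e / 2)^-1).
  by rewrite invf_plt ?posrE ?divr_gt0// truncnS_gt.
have k0 : 0 < k.+1%:R^-1 :> R by rewrite invr_gt0.
have /choice[c cP] : forall x : 'I_N, exists c : rat, `|p z 0 x - ratr c| < k.+1%:R^-1.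
  move=> x; have pk : p z 0 x - k.+1%:R^-1 < p z 0 x by rewrite ltrBlDr ltrDl.
  have [c] := rat_in_itvoo pk.
  rewrite in_itv/= => /andP[c1 c2]; exists c.
  by rewrite ger0_norm ?subr_ge0 ?ltW// ltrBlDr -ltrBlDl.
pose ck := (\row_x c x : 'rV[rat]_N, k).
have bz : box ck (p z) by move=> x; rewrite /= mxE.
exists (choice.pickle ck) => //; rewrite /A choice.pickleK; split => // q Dq bq.
have := He q _ Dq; rewrite /from_subspace.
suff bpq : ball (p z) e q.
  move=> /(_ bpq); rewrite ltr_norml => /andP[_]; rewrite ltrBlDr => ?; lra.
split => // i x; rewrite ord1 /ball/=.
have -> : p z 0 x - q 0 x = (p z 0 x - ratr (c x)) - (q 0 x - ratr (c x)) by ring.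
apply: le_lt_trans (ler_normB _ _) _.
rewrite [ltRHS](splitr e); apply: ltrD; first exact: lt_trans (cP x) ke.
by have := bq x; rewrite /= mxE => /lt_trans; exact.
Qed.

Lemma measurable_row_comb p q (a b : R) : measurable_row p -> measurable_row q ->
  measurable_row (fun z => a *: p z + b *: q z).
Proof.
move=> mp mq x.
rewrite (_ : (fun z => _) = (fun z => a * p z 0 x + b * q z 0 x)); last first.
  by apply/funext => z; rewrite !mxE.
by apply: measurable_funD; apply: measurable_funM => //; exact: measurable_cst.
Qed.

Lemma measurable_min_entry p : measurable_row p ->
  measurable_fun [set: T] (fun z => min_entry (p z)).
Proof.
move=> mp; rewrite /min_entry; elim: (index_enum _) => [|x s IH].
  by under eq_fun do rewrite big_nil; exact: measurable_cst.
by under eq_fun do rewrite big_cons; exact: measurable_minr.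
Qed.

Lemma measurable_joint d' (X : measurableType d') (f : 'rV[R]_N -> X -> R) p
    (v : T -> X) : jointly_measurable f -> measurable_row p ->
  measurable_fun [set: T] v -> measurable_fun [set: T] (fun z => f (p z) (v z)).
Proof.
move=> mf mp mv.
pose h z : N.-tuple R * X := ([tuple p z 0 x | x < N], v z).
have mh : measurable_fun [set: T] h.
  apply: measurable_fun_pair => //; apply/measurable_fun_tnthP => x.
  by rewrite (_ : _ \o _ = (fun z => p z 0 x))//; apply/funext => z /=; rewrite tnth_mktuple.
rewrite (_ : (fun z => _) = (fun z : N.-tuple R * X => f (\row_x tnth z.1 x) z.2) \o h).
  exact: (measurableT_comp mf mh).
apply/funext => z /=; congr (f _ _); apply/rowP => x.
by rewrite mxE tnth_mktuple.
Qed.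

Lemma measurable_finite (F : finType) (g : F -> R) (j : T -> F) :
  (forall y, measurable (j @^-1` [set y])) ->
  measurable_fun [set: T] (g \o j).
Proof.
move=> mj _ B mB; rewrite setTI.
rewrite (_ : _ @^-1` B = \bigcup_(y in [set y | B (g y)]) (j @^-1` [set y])).
  by apply: fin_bigcup_measurable => //; exact: finite_finset.
apply/seteqP; split => z; first by move=> Bz; exists (j z).
by move=> [y By /= jz]; rewrite /preimage/= jz.
Qed.

End row_measurability.

Section estimator_measurability.
Context {R : realType} {m : nat} {n : 'I_m -> nat}.
Local Notation N := (\sum_i n i)%N.
Context d d1 d2 {T : measurableType d} {E : measurableType d1} {X : measurableType d2}.
Variables (Zhat : 'rV[R]_N -> X -> R) (delta : R -> 'rV[R]_N -> E -> 'rV[R]_N).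
Hypothesis mZhat : jointly_measurable Zhat.
Hypothesis mdelta : forall c x, jointly_measurable (fun p e => delta c p e 0 x).

Lemma measurable_mix_block (p : T -> 'rV[R]_N) (j : T -> 'I_N) (c : R) :
  measurable_row p -> (forall y, measurable (j @^-1` [set y])) ->
  measurable_row (fun z => mix_block (p z) (j z) c).
Proof.
move=> mp mj y.
have mfin (g : 'I_N -> R) : measurable_fun [set: T] (fun z => g (j z)).
  exact: measurable_finite.
(* The case distinction becomes a choice of coefficients that depend on [z] only through the
   finite-valued [j z]. *)
rewrite (_ : (fun z => _) = (fun z =>
    (if tagnat.sig1 y == tagnat.sig1 (j z) then 1 - c else 1) * p z 0 y +
    (if tagnat.sig1 y == tagnat.sig1 (j z) then c * (y == j z)%:R else 0))).
  apply: measurable_funD; last first.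
    exact: (mfin (fun x => if tagnat.sig1 y == tagnat.sig1 x then c * (y == x)%:R else 0)).
  apply: measurable_funM => //.
  exact: (mfin (fun x => if tagnat.sig1 y == tagnat.sig1 x then 1 - c else 1)).
by apply/funext => z; rewrite mxE; case: ifP; rewrite ?mul1r ?addr0.
Qed.

Lemma measurable_multiplier (gamma0 : R) (p : T -> 'rV[R]_N) : measurable_row p ->
  (forall z x, 0 <= p z 0 x) ->
  measurable_fun [set: T] (fun z => multiplier gamma0 (p z)).
Proof.
move=> mp p0.
rewrite (_ : (fun z => _) = (fun z => gamma0 * (min_entry (p z) `^ (- 2%:R)))); last first.
  by apply/funext => z; rewrite powR_invn// min_entry_ge.
apply: measurable_funM; first exact: measurable_cst.
exact: (measurableT_comp (measurable_powR (- 2%:R)) (measurable_min_entry mp)).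
Qed.

(** Point, multiplier and seeds are arbitrary measurable functions on [T], which covers both a fixed
    point over [Om] and the product of past and noise. *)
Lemma measurable_estimator kind (c : R) (Rn : nat) (gam : T -> R)
    (p : T -> 'rV[R]_N) (eta : nat -> T -> E) (J : nat -> T -> 'I_N)
    (xi : nat -> T -> X) :
  measurable_fun [set: T] gam -> measurable_row p ->
  (forall t, measurable_fun [set: T] (eta t)) ->
  (forall t y, measurable (J t @^-1` [set y])) ->
  (forall t, measurable_fun [set: T] (xi t)) ->
  measurable_row (fun z => estimator Zhat delta kind c Rn (gam z) (p z)
    (eta^~ z) (J^~ z) (xi^~ z)).
Proof.
move=> mgam mp meta mJ mxi.
have mdel t : measurable_row (fun z => delta c (p z) (eta t z)).
  by move=> x; exact: (measurable_joint (mdelta c x)).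
have mscore t x : measurable_fun [set: T]
    (fun z => (gam z *: (delta c (p z) (eta t z) - p z)) 0 x).
  rewrite (_ : (fun z => _) = (fun z => gam z * (delta c (p z) (eta t z) 0 x - p z 0 x))).
    by apply: measurable_funM => //; apply: measurable_funB => //; exact: mdel.
  by apply/funext => z; rewrite !mxE.
have mZ q t : measurable_row q -> measurable_fun [set: T] (fun z => Zhat (q z) (xi t z)).
  by move=> mq; exact: measurable_joint.
have mavg (h : 'I_Rn -> T -> R) (v : 'I_Rn -> T -> 'rV[R]_N) x :
    (forall t, measurable_fun [set: T] (h t)) ->
    (forall t, measurable_fun [set: T] (fun z => v t z 0 x)) ->
    measurable_fun [set: T] (fun z => (Rn%:R^-1 *: \sum_(t < Rn) h t z *: v t z) 0 x).
  move=> mh mv.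
  rewrite (_ : (fun z => _) = (fun z => Rn%:R^-1 * \sum_(t < Rn) h t z * v t z 0 x)).
    apply: measurable_funM => //; apply: measurable_sum => t; exact: measurable_funM.
  by apply/funext => z; rewrite mxE summxE; congr (_ * _); apply: eq_bigr => t _; rewrite mxE.
have mfd (j : T -> 'I_N) t : (forall y, measurable (j @^-1` [set y])) ->
    measurable_fun [set: T] (fun z => (Zhat (mix_block (p z) (j z) c) (xi (2 * t)%N z) -
      Zhat (p z) (xi (2 * t + 1)%N z)) / c).
  move=> mj; apply: measurable_funM => //; apply: measurable_funB; apply: mZ => //.
  exact: measurable_mix_block.
have mfwd t : measurable_row (fun z => (1 - c) *: p z + c *: delta c (p z) (eta t z)).
  exact: measurable_row_comb.
have mbwd t : measurable_row (fun z => (1 + c) *: p z - c *: delta c (p z) (eta t z)).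
  rewrite (_ : (fun z => _) = (fun z => (1 + c) *: p z + (- c) *: delta c (p z) (eta t z))).
    exact: measurable_row_comb.
  by apply/funext => z; rewrite scaleNr.
move=> x; rewrite /estimator; case: kind.
- apply: (mavg (fun t z => Zhat _ _ / c)) => // t.
  by apply: measurable_funM => //; exact: mZ.
- apply: (mavg (fun t z => (Zhat _ _ - Zhat _ _) / c)) => // t.
  by apply: measurable_funM => //; apply: measurable_funB; exact: mZ.
- apply: (mavg (fun t z => (Zhat _ _ - Zhat _ _) / (2 * c))) => // t.
  by apply: measurable_funM => //; apply: measurable_funB; exact: mZ.
- under eq_fun do rewrite mxE.
  apply: measurable_funM => //.
  rewrite (_ : (fun z => _) = (fun z => \sum_(t < Rn) ((t %% N)%N == x)%:R *
     ((Zhat (mix_block (p z) x c) (xi (2 * t)%N z) -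
      Zhat (p z) (xi (2 * t + 1)%N z)) / c))).
    apply: measurable_sum => t; apply: measurable_funM => //.
    apply: (mfd (fun=> x)) => y; rewrite (_ : _ @^-1` _ = [set z | x = y])//.
    have [->|xy] := eqVneq x y.
      by rewrite (_ : [set _ | _] = setT)//; apply/seteqP; split.
    by rewrite (_ : [set _ | _] = set0)//; apply/seteqP;
      split => // z /eqP; rewrite (negbTE xy).
  apply/funext => z; rewrite big_mkcond; apply: eq_bigr => t _.
  by case: ifP; rewrite ?mul1r ?mul0r.
- apply: (mavg (fun t z => N%:R * ((Zhat _ _ - Zhat _ _) / c))
    (fun t z => delta_mx 0 (J t z))) => t.
    by apply: measurable_funM => //; exact: mfd.
  apply: (@measurable_finite _ _ _ _ (fun y => (delta_mx 0 y : 'rV[R]_N) 0 x) (J t)).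
  exact: mJ.
Qed.

End estimator_measurability.

(** * Mean squared error of the estimators *)

Section estimator_spread.
Context {R : realType} {m : nat} {n : 'I_m -> nat}.
Local Notation N := (\sum_i n i)%N.
Context {d d1 d2 : measure_display} {Om : measurableType d}
  {E : measurableType d1} {X : measurableType d2}.
Variables (P : probability Om R) (Qe : probability E R) (Qx : probability X R)
  (Z : 'rV[R]_N -> R) (L0 L1 L2 : R)
  (Zhat : 'rV[R]_N -> X -> R) (delta : R -> 'rV[R]_N -> E -> 'rV[R]_N)
  (kind : estimator_kind) (S : set 'rV[R]_N) (F : nat -> set_system Om)
  (eta : nat -> nat -> Om -> E) (J : nat -> nat -> Om -> 'I_N)
  (xi : nat -> nat -> Om -> X) (gamma0 B1 B2 : R) (eps0 : 'rV[R]_N -> R).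
Hypothesis smoothZ : smooth_objective Z L0 L1 L2.
Hypothesis mZhat : jointly_measurable Zhat.
Hypothesis mdelta : forall c x, jointly_measurable (fun p e => delta c p e 0 x).
Hypothesis fresh : fresh_sampling P Qe Qx F eta J xi.
Hypothesis gamma0_gt0 : 0 < gamma0.
Hypothesis Ssub : S `<=` simplices.

(* [estimator_bounds] is this property for all small c > 0. *)
Definition bounds_at (c : R) : Prop :=
  forall (k Rn : nat) (p : 'rV[R]_N),
    enough_replications (n := n) kind Rn -> S p -> (forall x, 0 < p 0 x) ->
    let gam := multiplier gamma0 p in
    let est := psihat Zhat delta kind eta J xi k c Rn gam p in
    exists psi : 'rV[R]_N,
      [/\ forall x, ('E_P[fun w => est w 0%R x] = (psi 0%R x)%:E)%E,
          enorm (psi - grad Z p - const_mx (eps0 p)) <= B1 * c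
        & ('E_P[fun w => (enorm (est w - psi) ^+ 2)%R] <=
           (B2 * (gam / (Rn%:R * c ^+ 2)))%:E)%E].

Definition residual_spread x0 k c Rn (z : 'rV[R]_N * Om) : R :=
  sqr_spread x0 (psihat Zhat delta kind eta J xi k c Rn (multiplier gamma0 z.1) z.1 z.2
    - grad Z z.1).

(** Variance plus squared bias, with the multiplier controlled by a lower bound [mu] on the entries;
    the prefactor is that of [sqr_spread_le]. *)
Definition spread_bound (c mu : R) (Rn : nat) : R :=
  4 * (1 + N%:R) * (`|B2| * (gamma0 * mu ^- 2 / (Rn%:R * c ^+ 2)) + (B1 * c) ^+ 2).

Lemma measurable_sqr_spread d' (T : measurableType d') x0 (v : T -> 'rV[R]_N) :
  measurable_row v -> measurable_fun [set: T] (fun z => sqr_spread x0 (v z)).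
Proof.
move=> mv; rewrite /sqr_spread; apply: measurable_sum => x.
by apply: measurable_funX; apply: measurable_funB.
Qed.

Lemma measurable_psihat k c Rn gam p :
  measurable_row (psihat Zhat delta kind eta J xi k c Rn gam p).
Proof.
apply: (@measurable_estimator _ _ _ _ _ _ Om _ _ _ _ mZhat mdelta kind c Rn
  (fun=> gam) (fun=> p) (eta k) (J k) (xi k)) => //.
- exact: (eta_measurable fresh).
- exact: (J_measurable fresh).
- exact: (xi_measurable fresh).
Qed.

Lemma measurable_rowB d' (T : measurableType d') (v u : T -> 'rV[R]_N) :
  measurable_row v -> measurable_row u -> measurable_row (fun z => v z - u z).
Proof.
move=> mv mu x; under eq_fun do rewrite !mxE.
by apply: measurable_funB.
Qed.

Lemma residual_spread_expectation_le x0 k c Rn p mu :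
  bounds_at c -> enough_replications (n := n) kind Rn -> S p ->
  0 < mu -> mu <= 1 -> (forall x, mu <= p 0 x) ->
  (\int[P]_w (residual_spread x0 k c Rn (p, w))%:E <= (spread_bound c mu Rn)%:E)%E.
Proof.
move=> bc enough Sp mu0 mu1 pmu.
have p0 x : 0 < p 0 x by exact: lt_le_trans (pmu x).
have [psi [_ psi1 psi2]] := bc k Rn p enough Sp p0.
rewrite unlock in psi2.
set est := psihat _ _ _ _ _ _ _ _ _ _ _ in psi2.
have mest : measurable_row est by exact: measurable_psihat.
pose C : R := 4 * (1 + N%:R).
have C0 : 0 <= C by rewrite mulr_ge0// addr_ge0.
pose f w := enorm (est w - psi) ^+ 2.
have mf : measurable_fun [set: Om] f.
  rewrite /f; under eq_fun do rewrite sqr_enorm.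
  apply: measurable_sum => x; apply: measurable_funX.
  by apply: (measurable_rowB mest) => y /=; exact: measurable_cst.
have f0 w : 0 <= f w by exact: sqr_ge0.
have psi0 := sqr_ge0 (B1 * c).
apply: (@le_trans _ _ (\int[P]_w ((C * f w)%:E + (C * (B1 * c) ^+ 2)%:E))%E).
  apply: ge0_le_integral => //.
  - by move=> w _; rewrite lee_fin sqr_spread_ge0.
  - apply/measurable_EFinP; apply: measurable_sqr_spread.
    by apply: (measurable_rowB mest) => y /=; exact: measurable_cst.
  - have mCf : measurable_fun [set: Om] (fun w => C * f w) by exact: measurable_funM.
    apply: (@emeasurable_funD _ _ _ _ (fun w => (C * f w)%:E)) => //.
    exact/measurable_EFinP.
  - move=> w _; rewrite -EFinD lee_fin -mulrDr.
    (* The residual splits into noise, bias and a multiple of the all-ones vector, which the spread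
       ignores. *)
    have -> : residual_spread x0 k c Rn (p, w) =
        sqr_spread x0 ((est w - psi) +
          ((psi - grad Z p - const_mx (eps0 p)) + const_mx (eps0 p))).
      by rewrite /residual_spread/= -/(est w) subrK addrA subrK.
    apply: le_trans (sqr_spread_le _ _ _ _) _; rewrite ler_wpM2l// lerD2l.
    by rewrite lerXn2r// nnegrE ?enorm_ge0// (le_trans (enorm_ge0 _) psi1).
rewrite ge0_integralD//; last 3 first.
- by move=> w _; rewrite lee_fin mulr_ge0.
- by apply/measurable_EFinP; exact: measurable_funM.
- by move=> w _; rewrite lee_fin mulr_ge0.
have := expectation_cst P (C * (B1 * c) ^+ 2); rewrite unlock => ->.
under eq_integral do rewrite EFinM.
rewrite ge0_integralZl_EFin//; last 2 first.
- by move=> w _; rewrite lee_fin.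
- exact/measurable_EFinP.
rewrite /spread_bound -/C mulrDr EFinD leeD2r//.
rewrite [leRHS]EFinM; apply: lee_wpmul2l; first by rewrite lee_fin.
apply: le_trans psi2 _; rewrite lee_fin.
have g0 : 0 <= multiplier gamma0 p by rewrite mulr_ge0 ?(ltW gamma0_gt0)// invr_ge0 sqr_ge0.
have mup := min_entry_ge mu1 pmu.
have Rc : 0 <= (Rn%:R * c ^+ 2)^-1 by rewrite invr_ge0 mulr_ge0// sqr_ge0.
apply: le_trans (ler_wpM2r _ (ler_norm _)) _; first by rewrite mulr_ge0.
rewrite ler_wpM2l// ler_wpM2r// ler_pM2l// lef_pV2 ?posrE ?exprn_gt0//.
  by rewrite lerXn2r// nnegrE ltW// (lt_le_trans mu0).
by rewrite (lt_le_trans mu0).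
Qed.

(** On the product of past and noise, [q] reads the first coordinate and the seeds the second, so
    the estimate at fixed points can be integrated with the past frozen. *)
Lemma residual_spread_past_le x0 k c Rn (q : Om -> 'rV[R]_N) mu :
  bounds_at c -> enough_replications (n := n) kind Rn ->
  (forall w, S (q w)) -> 0 < mu -> mu <= 1 -> (forall w x, mu <= q w 0 x) ->
  measurable_row (q : g_sigma_algebraType (F k) -> 'rV[R]_N) ->
  measurable_fun [set: Om] (fun w => residual_spread x0 k c Rn (q w, w)) /\
  (\int[P]_w (residual_spread x0 k c Rn (q w, w))%:E <= (spread_bound c mu Rn)%:E)%E.
Proof.
move=> bc enough Sq mu0 mu1 qmu mq.
pose NT := g_sigma_algebraType (noise F eta J xi k).
pose T := (g_sigma_algebraType (F k) * NT)%type.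
have noiseP s : sources (F k) (eta k) (J k) (xi k) (Some s) `<=`
    @measurable _ NT.
  by move=> A sA; apply: sub_sigma_algebra; exists s.
have meta t : measurable_fun [set: NT] (eta k t : NT -> E).
  move=> _ B mB; rewrite setTI.
  by apply: (noiseP (inl (inl t)) (eta k t @^-1` B)); exists B.
have mxi t : measurable_fun [set: NT] (xi k t : NT -> X).
  move=> _ B mB; rewrite setTI.
  by apply: (noiseP (inr t) (xi k t @^-1` B)); exists B.
have mJ t y : @measurable _ NT (J k t @^-1` [set y]).
  by apply: (noiseP (inl (inr t)) (J k t @^-1` [set y])); exists [set y].
have msnd : measurable_fun [set: T] (snd : T -> NT) by exact: measurable_snd.
have mq1 : measurable_row (fun z : T => q z.1).
  by move=> x; exact: (measurableT_comp (mq x) measurable_fst).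
have mf : measurable_fun [set: T] (fun z => residual_spread x0 k c Rn (q z.1, z.2)).
  rewrite /residual_spread/=; apply: measurable_sqr_spread; apply: measurable_rowB.
    apply: (@measurable_estimator _ _ _ _ _ _ T _ _ _ _ mZhat mdelta kind c Rn
      (fun z => multiplier gamma0 (q z.1)) (fun z => q z.1)
      (fun t z => eta k t z.2) (fun t z => J k t z.2) (fun t z => xi k t z.2)) => //.
    - apply: measurable_multiplier => // z y.
      exact/ltW/(lt_le_trans mu0)/qmu.
    - by move=> t; exact: (measurableT_comp (meta t) measurable_snd).
    - move=> t y; rewrite -[X in measurable X]setTI.
      exact: (msnd measurableT _ (mJ t y)).
    - by move=> t; exact: (measurableT_comp (mxi t) measurable_snd).
  move=> x.
  apply: (@measurable_continuous_within _ _ T _ simplices (fun v => grad Z v 0 x)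
    (fun z => q z.1)) => //.
    apply/subspace_continuousP => v Sv.
    have /subspace_continuousP/(_ v Sv) gc := C2_grad_continuous (objective_C2 smoothZ).
    exact: (cvg_comp _ _ gc (@coord_continuous R 1 N 0 x (grad Z v))).
  by move=> z; apply: Ssub; exact: Sq.
split; last first.
  apply: (@integral_past_noise_le _ _ _ _ _ _ _ _ _ _ _ _ _ _ _ fresh k
    (fun z => residual_spread x0 k c Rn (q z.1, z.2))) => // [z|w].
    exact: sqr_spread_ge0.
  exact: (@residual_spread_expectation_le x0 k c Rn (q w) mu bc enough (Sq w)
    mu0 mu1 (qmu w)).
move=> _ B mB; rewrite setTI.
have := diagonal_measurable (k := k) fresh measurableT (mf measurableT B mB).
by rewrite !setTI.
Qed.

(** Exponent count: in the variance term the multiplier contributes [2 a], the perturbation size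
    [2 theta] and the replications [- beta]; the squared bias has exponent [- 2 theta]. Both are at
    most [- 2 del]. *)
Lemma spread_bound_rate (a b theta beta R0 C0 del x : R) (Rn : nat) :
  0 < b -> 0 < R0 -> 0 < C0 -> 1 <= x -> del <= theta ->
  2 * del <= beta - 2 * (a + theta) -> R0 * x `^ beta <= Rn%:R ->
  spread_bound (b / x `^ theta) (C0 * x `^ (- a)) Rn <=
  4 * (1 + N%:R) * (`|B2| * (gamma0 / (C0 ^+ 2 * R0 * b ^+ 2)) + (B1 * b) ^+ 2) *
    x `^ (- (2 * del)).
Proof.
move=> b0 R00 C00 x1 dt db Rnx; have x0 : 0 < x by exact: lt_le_trans x1.
have sqrE r : (x `^ r) ^+ 2 = x `^ (2 * r).
  by rewrite -powR_mulrn ?powR_ge0// -powRrM mulrC.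
have xD r s : x `^ (r + s) = x `^ r * x `^ s by rewrite powRD// (gt_eqF x0) implybT.
rewrite /spread_bound -[leRHS]mulrA ler_wpM2l ?mulr_ge0 ?addr_ge0// mulrDl lerD//.
  rewrite -[leRHS]mulrA ler_wpM2l//.
  apply: (@le_trans _ _ (gamma0 * (C0 * x `^ (- a)) ^- 2 /
      (R0 * x `^ beta * (b / x `^ theta) ^+ 2))).
    apply: ler_wpM2l; first by rewrite mulr_ge0 ?(ltW gamma0_gt0)// invr_ge0 sqr_ge0.
    rewrite lef_pV2 ?posrE ?mulr_gt0 ?exprn_gt0 ?divr_gt0 ?invr_gt0 ?powR_gt0//.
      by rewrite ler_wpM2r ?sqr_ge0.
    by rewrite (lt_le_trans _ Rnx)// mulr_gt0// powR_gt0.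
  rewrite [leLHS](_ : _ = gamma0 / (C0 ^+ 2 * R0 * b ^+ 2) *
      x `^ (2 * a + 2 * theta - beta)).
    apply: ler_wpM2l; first by rewrite ltW// divr_gt0// !mulr_gt0// exprn_gt0.
    by rewrite ler_powR//; lra.
  rewrite !xD -!sqrE !powRN; field.
  by rewrite !gt_eqF ?powR_gt0.
rewrite mulrA exprMn -powRN sqrE ler_wpM2l ?sqr_ge0// ler_powR//; lra.
Qed.

End estimator_spread.

(** * Convergence of the iteration *)

Section convexity.
Context {R : realType} {m : nat} {n : 'I_m -> nat}.
Local Notation N := (\sum_i n i)%N.

Lemma prod_set_convex (U : forall i : 'I_m, set 'rV[R]_(n i)) (p q : 'rV[R]_N) (t : R) :
  (forall i, convex_set (U i)) -> 0 <= t -> t <= 1 ->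
  prod_set U p -> prod_set U q -> prod_set U ((1 - t) *: p + t *: q).
Proof.
move=> cU t0 t1 Up Uq i.
have := cU i _ _ (Itv01 t0 t1) (mem_set (Uq i)) (mem_set (Up i)).
move=> /set_mem; congr (U i _); apply/rowP => j.
by rewrite !mxE /= addrC.
Qed.

End convexity.

Section fwsa.
Context {R : realType} {m : nat} {n : 'I_m -> nat}.
Local Notation N := (\sum_i n i)%N.
Context {d d1 d2 : measure_display} {Om : measurableType d}
  {E : measurableType d1} {X : measurableType d2}.
Variables (P : probability Om R) (Qe : probability E R) (Qx : probability X R)
  (Z : 'rV[R]_N -> R) (L0 L1 L2 : R)
  (Zhat : 'rV[R]_N -> X -> R) (delta : R -> 'rV[R]_N -> E -> 'rV[R]_N)
  (kind : estimator_kind) (U : forall i : 'I_m, set 'rV[R]_(n i))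
  (F : nat -> set_system Om)
  (eta : nat -> nat -> Om -> E) (J : nat -> nat -> Om -> 'I_N)
  (xi : nat -> nat -> Om -> X) (gamma0 B1 B2 : R) (eps0 : 'rV[R]_N -> R)
  (a b theta beta R0 : R) (p1 : 'rV[R]_N) (p qhat : nat -> Om -> 'rV[R]_N).
Arguments U : clear implicits.
Hypothesis Usub : forall i, U i `<=` simplex.
Hypothesis Uclosed : forall i, closed (U i).
Hypothesis Uconvex : forall i, convex_set (U i).
Hypothesis smoothZ : smooth_objective Z L0 L1 L2.
Hypothesis mZhat : jointly_measurable Zhat.
Hypothesis mdelta : forall c x, jointly_measurable (fun p e => delta c p e 0 x).
Hypothesis gapZ : regular_gap Z (prod_set U).
Hypothesis fresh : fresh_sampling P Qe Qx F eta J xi.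
Hypothesis bounds :
  estimator_bounds P Z Zhat delta kind (prod_set U) eta J xi gamma0 B1 B2 eps0.
Hypothesis a_gt0 : 0 < a.
Hypothesis a_le : a <= 1 / 2.
Hypothesis b_gt0 : 0 < b.
Hypothesis theta_gt0 : 0 < theta.
Hypothesis R0_gt0 : 0 < R0.
Hypothesis beta_gt : 2 * (a + theta) < beta.
Hypothesis gamma0_gt0 : 0 < gamma0.
Hypothesis Up1 : prod_set U p1.
Hypothesis p1_gt0 : forall x, 0 < p1 0 x.

Let cn (k : nat) : R := b / (k%:R `^ theta).
Let Rn (k : nat) : nat := (Num.truncn (R0 * (k%:R `^ beta))).+1.

Hypothesis iteration : FWSA Zhat delta kind (prod_set U) eta J xi F
  (fun k => a / k%:R) cn Rn (multiplier gamma0) p1 p qhat.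

Let Ssub : prod_set U `<=` simplices.
Proof. by move=> q Uq i; apply: Usub; exact: Uq. Qed.

Let step_le1 k : (0 < k)%N -> a / k%:R <= 1.
Proof.
move=> k0; rewrite ler_pdivrMr ?ltr0n// mul1r; apply: le_trans (_ : 1 <= _).
  by apply: le_trans a_le _; rewrite ler_pdivrMr// mul1r ler1n.
by rewrite ler1n.
Qed.

Let step_ge0 k : 0 <= a / k%:R.
Proof. by rewrite divr_ge0// ltW. Qed.

Lemma iterate_feasible k w : (0 < k)%N -> prod_set U (p k w).
Proof.
elim: k => [//|[_ _|k IH _]]; first by rewrite (FWSA_start iteration).
rewrite (FWSA_step iteration)//; apply: prod_set_convex => //.
- exact: step_le1.
- exact: IH.
- exact: (FWSA_direction iteration w (ltn0Sn k)).1.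
Qed.

(** A step adds a nonnegative multiple of [qhat], so each entry shrinks at most by the factor
    [1 - a / k]. *)
Lemma iterate_lower_bound k w x : (0 < k)%N ->
  (1 - a) * p1 0 x * k%:R `^ (- a) <= p k w 0 x.
Proof.
move=> k0; rewrite -(FWSA_start iteration w).
apply: (product_decay a_gt0 a_le (u := fun k => p k w 0 x)) => //.
  by rewrite (FWSA_start iteration).
move=> j j0; rewrite (FWSA_step iteration)// !mxE lerDl mulr_ge0//.
apply: simplices_ge0; apply: Ssub; exact: (FWSA_direction iteration w j0).1.
Qed.

Lemma iterate_measurable k : (0 < k)%N ->
  measurable_row (p k : g_sigma_algebraType (F k) -> 'rV[R]_N).
Proof.
have [sF mF FS] := sampling_filtration fresh.
elim: k => [//|[_ _|k IH _]] x.
  under eq_fun do rewrite (FWSA_start iteration); exact: measurable_cst.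
have mp : measurable_row (p k.+1 : g_sigma_algebraType (F k.+2) -> 'rV[R]_N).
  move=> y _ B mB; rewrite setTI; apply: sub_sigma_algebra; apply: FS.
  have := IH isT y measurableT B mB.
  by rewrite setTI measurable_g_measurableTypeE.
have mq : measurable_row (qhat k.+1 : g_sigma_algebraType (F k.+2) -> 'rV[R]_N).
  move=> y _ B mB; rewrite setTI; apply: sub_sigma_algebra.
  exact: (FWSA_direction_measurable iteration).
under eq_fun do rewrite (FWSA_step iteration)//.
exact: measurable_row_comb.
Qed.

(** The perturbation sizes tend to 0 and the replication numbers to infinity, as [theta] and [beta]
    are positive. *)
Lemma eventually_bounds : exists2 K, (0 < K)%N & forall k, (K <= k)%N ->
  bounds_at P Z Zhat delta kind (prod_set U) eta J xi gamma0 B1 B2 eps0 (cn k) /\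
  enough_replications (n := n) kind (Rn k).
Proof.
have beta0 : 0 < beta by apply: le_lt_trans beta_gt; rewrite mulr_ge0// addr_ge0// ltW.
have : \forall c \near (0 : R)^'+,
  bounds_at P Z Zhat delta kind (prod_set U) eta J xi gamma0 B1 B2 eps0 c := bounds.
rewrite /at_right near_withinE => /nbhs_ballP[r /= r0 br].
have [K1 K1P] := powR_unbounded (b / r) theta_gt0.
have [K2 K2P] := powR_unbounded (N%:R / R0) beta0.
exists (maxn 1 (maxn K1 K2)) => [|k]; first by rewrite leq_max.
rewrite !geq_max => /and3P[k0 k1 k2].
have kt : 0 < k%:R `^ theta :> R by rewrite powR_gt0// ltr0n.
split.
  apply: br; last by rewrite divr_gt0.
  rewrite /ball/= sub0r normrN gtr0_norm ?divr_gt0// /cn.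
  by rewrite ltr_pdivrMr// mulrC -ltr_pdivrMr// K1P.
have NR : (N <= Rn k)%N.
  rewrite -(ler_nat R) ltW// (lt_trans _ (truncnS_gt _))//.
  by rewrite mulrC -ltr_pdivrMr// K2P.
by rewrite /enough_replications; case: kind.
Qed.

(* The mean squared error decays like k^(-2 rate); the cap at 1 is what
   [sum_powR_le] requires. *)
Let rate : R := Num.min (Num.min theta ((beta - 2 * (a + theta)) / 2)) 1.

(** The weights [k^rate] come from [|y| <= k^-rate + k^rate y^2]. Expected terms are of order
    [k^-1 k^rate k^(-2 rate)], that is [k^-(1 + rate)], which is summable. *)
Lemma ae_error_series : exists (x0 : 'I_N) (K : nat), (0 < K)%N /\
  {ae P, forall w, exists M, forall i,
    \sum_(0 <= j < i) a / (K + j)%:R * (K + j)%:R `^ rate *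
      residual_spread Z Zhat delta kind eta J xi gamma0 x0 (K + j)
        (cn (K + j)) (Rn (K + j)) (p (K + j) w, w) <= M}.
Proof.
(* A value of the random coordinate shows that there is at least one coordinate. *)
have x0 : 'I_N by exact: (J 0 0 point).
have [K K0 KP] := eventually_bounds.
exists x0, K; split => //.
have rate_gt0 : 0 < rate.
  by rewrite !lt_min theta_gt0 ltr01 divr_gt0// subr_gt0.
have [rate_le1 rate_theta rate_beta] :
    [/\ rate <= 1, rate <= theta & 2 * rate <= beta - 2 * (a + theta)].
  split; rewrite /rate ?ge_min ?lexx ?orbT//.
  rewrite -ler_pdivlMl// mulrC; rewrite ?ge_min ?lexx ?orbT//.
have [c [c0 c1 cp1]] := positive_lower_bound p1_gt0.
have a1 : 0 < 1 - a by rewrite subr_gt0 (le_lt_trans a_le)//; lra.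
(* [C0 * k^-a] bounds all entries of the iterate from below, in the role of [mu]. *)
pose C0 := (1 - a) * c.
have C00 : 0 < C0 by rewrite mulr_gt0.
pose B : R := 4 * (1 + N%:R) *
  (`|B2| * (gamma0 / (C0 ^+ 2 * R0 * b ^+ 2)) + (B1 * b) ^+ 2).
pose H k w := residual_spread Z Zhat delta kind eta J xi gamma0 x0 k
  (cn k) (Rn k) (p k w, w).
have k1 j : 1 <= (K + j)%:R :> R by rewrite ler1n addn_gt0 K0.
have kgt0 j : 0 < (K + j)%:R :> R by exact: lt_le_trans (k1 j).
have Hk j : measurable_fun [set: Om] (H (K + j)%N) /\
    (\int[P]_w (H (K + j)%N w)%:E <= (B * (K + j)%:R `^ (- (2 * rate)))%:E)%E.
  have [bk ek] := KP (K + j)%N (leq_addr _ _).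
  have Kj0 : (0 < K + j)%N by rewrite addn_gt0 K0.
  have [|||mH IH] := residual_spread_past_le smoothZ mZhat mdelta fresh gamma0_gt0 Ssub x0
    bk ek (fun w => iterate_feasible w Kj0) (mu := C0 * (K + j)%:R `^ (- a)) _ _ _
    (iterate_measurable Kj0).
  - by rewrite mulr_gt0// powR_gt0.
  - rewrite mulr_ile1 ?(ltW C00) ?powR_ge0//.
      by rewrite mulr_ile1 ?(ltW a1) ?(ltW c0)// gerBl ltW.
    by rewrite powRN invf_le1 ?powR_gt0//;
      have := ler_powR (k1 j) (ltW a_gt0); rewrite powRr0.
  - move=> w x; apply: le_trans (iterate_lower_bound w x Kj0).
    by rewrite ler_wpM2r ?powR_ge0// ler_wpM2l// ltW.
  split => //; apply: le_trans IH _; rewrite lee_fin.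
  apply: (spread_bound_rate _ _ gamma0_gt0 b_gt0 R0_gt0 C00 (k1 j) rate_theta rate_beta).
  exact/ltW/truncnS_gt.
have B0 : 0 <= B.
  rewrite mulr_ge0 ?mulr_ge0 ?addr_ge0 ?sqr_ge0// mulr_ge0//.
  by rewrite ltW// divr_gt0// !mulr_gt0// exprn_gt0.
have e0 j : 0 <= a / (K + j)%:R * (K + j)%:R `^ rate.
  by apply: mulr_ge0; [exact: step_ge0|exact: powR_ge0].
apply: (@ae_series_bounded _ _ _ _ _ (a * B * (1 + rate^-1))).
- by move=> j; apply: measurable_funM => //; exact: (Hk j).1.
- by move=> j w; apply: (mulr_ge0 (e0 j)); exact: sqr_spread_ge0.
move=> i.
apply: (@le_trans _ _ (\sum_(0 <= j < i) (a * B * (K + j)%:R `^ (- (1 + rate)))%:E)%E).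
  apply: lee_sum => j _.
  under eq_integral do rewrite EFinM.
  rewrite ge0_integralZl_EFin//; last 2 first.
  - by move=> w _; rewrite lee_fin sqr_spread_ge0.
  - exact/measurable_EFinP/(Hk j).1.
  apply: le_trans (lee_wpmul2l _ (Hk j).2) _; first by rewrite lee_fin.
  rewrite -EFinM lee_fin le_eqVlt; apply/orP; left; apply/eqP.
  rewrite (_ : - (1 + rate) = -1 + (rate + - (2 * rate))); last by ring.
  have kn0 : (K + j)%:R != 0 :> R by rewrite gt_eqF.
  rewrite !powRD ?kn0 ?implybT// powR_inv1 ?ler0n//; ring.
rewrite sumEFin lee_fin -mulr_sumr; apply: ler_wpM2l.
  exact: (mulr_ge0 (ltW a_gt0) B0).
exact: sum_shifted_powR_le.
Qed.

Lemma ae_value_limit : {ae P, forall w, exists q,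
  [/\ prod_set U q, FW_gap Z (prod_set U) q = 0 & Z (p k w) @[k --> \oo] --> Z q]}.
Proof.
have [x0 [K [K0 Hae]]] := ae_error_series.
apply: filterS Hae => w [M sumM].
have rate_gt0 : 0 < rate.
  by rewrite !lt_min theta_gt0 ltr01 divr_gt0// subr_gt0.
have rate_le1 : rate <= 1 by rewrite /rate ge_min lexx orbT.
have Kj0 j : (0 < K + j)%N by rewrite addn_gt0 K0.
have kgt0 j : 0 < (K + j)%:R :> R by rewrite ltr0n.
pose H j := residual_spread Z Zhat delta kind eta J xi gamma0 x0 (K + j)
  (cn (K + j)) (Rn (K + j)) (p (K + j) w, w).
have H0 j : 0 <= H j by exact: sqr_spread_ge0.
pose e j : R := a / (K + j)%:R.
pose t j : R := (K + j)%:R `^ (- rate).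
have t0 j : 0 < t j by rewrite powR_gt0.
have e0 j : 0 <= e j by exact: step_ge0.
(* Three summable parts: [e t] of order [k^-(1 + rate)], the almost surely bounded error series, and
   the curvature of order [k^-2]. *)
pose s j := e j * (N%:R * t j + (t j)^-1 * H j) + N%:R * (`|L1| * (N%:R * e j) * e j).
have [|j|j|B|q [Uq gq Zq]] := @FW_values_cvg _ _ _ _ _ _ _ _ smoothZ Ssub gapZ
  (compact_prod_set Uclosed Ssub) (fun j => p (K + j)%N w)
  (fun j => iterate_feasible w (Kj0 j)) e s
  (N%:R * a * (1 + rate^-1) + M + N%:R * (`|L1| * N%:R) * a ^+ 2 * (1 + 1^-1)) e0.
- move=> j; rewrite addr_ge0// ?mulr_ge0 ?addr_ge0 ?mulr_ge0 ?invr_ge0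
    ?(ltW (t0 j)) ?(ltW a_gt0)//.
- rewrite addnS (FWSA_step iteration)//.
  apply: (FW_descent_step smoothZ Ssub gapZ x0 (t0 j) (e0 j) (step_le1 (Kj0 j))).
    exact: iterate_feasible.
  exact: (FWSA_direction iteration w (Kj0 j)).
- have -> : \sum_(0 <= i < j) s i =
      N%:R * a * \sum_(0 <= i < j) (K + i)%:R `^ (- (1 + rate)) +
      \sum_(0 <= i < j) a / (K + i)%:R * (K + i)%:R `^ rate * H i +
      N%:R * (`|L1| * N%:R) * a ^+ 2 * \sum_(0 <= i < j) (K + i)%:R `^ (- (1 + 1)).
    rewrite !mulr_sumr -!big_split/=; apply: eq_bigr => i _.
    have kn0 : (K + i)%:R != 0 :> R by rewrite gt_eqF.
    rewrite /s /e /t !opprD !powRD ?kn0 ?implybT// !powRN !powRr1 ?ler0n// invrK.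
    by ring.
  rewrite lerD// ?lerD//.
  + by rewrite ler_wpM2l ?mulr_ge0 ?(ltW a_gt0)// sum_shifted_powR_le.
  + apply: ler_wpM2l; last exact: sum_shifted_powR_le.
    by rewrite mulr_ge0 ?sqr_ge0// mulr_ge0// mulr_ge0.
- exact: harmonic_unbounded.
exists q; split => //.
(* The pathwise argument starts at index [K], where the estimator bounds set in. *)
rewrite -(cvg_shiftn K) /=.
by under eq_fun do rewrite addnC.
Qed.

End fwsa.

Theorem theorem9 (R : realType) (m : nat) (n : 'I_m -> nat)
    (U : forall i : 'I_m, set 'rV[R]_(n i))
    (Z : 'rV[R]_(\sum_i n i) -> R)
    (d d1 d2 : measure_display) (Om : measurableType d)
    (E : measurableType d1) (X : measurableType d2)
    (P : probability Om R) (Qe : probability E R) (Qx : probability X R)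
    (Zhat : 'rV[R]_(\sum_i n i) -> X -> R)
    (delta : R -> 'rV[R]_(\sum_i n i) -> E -> 'rV[R]_(\sum_i n i))
    (kind : estimator_kind)
    (F : nat -> set_system Om)
    (eta : nat -> nat -> Om -> E) (J : nat -> nat -> Om -> 'I_(\sum_i n i))
    (xi : nat -> nat -> Om -> X)
    (L0 L1 L2 sigma B1 B2 a b theta beta R0 gamma0 : R)
    (eps0 : 'rV[R]_(\sum_i n i) -> R)
    (p1 : 'rV[R]_(\sum_i n i)) (p qhat : nat -> Om -> 'rV[R]_(\sum_i n i)) :
  (forall i, U i `<=` simplex) ->
  (forall i, closed (U i)) ->
  (forall i, convex_set (U i)) ->
  smooth_objective Z L0 L1 L2 ->
  0 < sigma ->
  noisy_evaluation Qx simplices Z Zhat sigma ->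
  regular_gap Z (prod_set U) ->
  perturbation simplices delta ->
  fresh_sampling P Qe Qx F eta J xi ->
  estimator_bounds P Z Zhat delta kind (prod_set U) eta J xi gamma0 B1 B2 eps0 ->
  0 < a -> a <= 1 / 2 ->
  0 < b -> 0 < theta ->
  0 < R0 -> 2 * (a + theta) < beta ->
  0 < gamma0 ->
  prod_set U p1 -> (forall x, 0 < p1 0 x) ->
  FWSA Zhat delta kind (prod_set U) eta J xi F
    (fun k => a / k%:R)
    (fun k => b / (k%:R `^ theta))
    (fun k => (Num.truncn (R0 * (k%:R `^ beta))).+1)
    (multiplier gamma0) p1 p qhat ->
  {ae P, forall w,
    dist_set (Z (p k w)) (stationary_values Z (prod_set U)) @[k --> \oo]
      --> 0%E} /\
  (forall pstar, unique_stationary_minimizer Z (prod_set U) pstar ->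
    {ae P, forall w, p k w @[k --> \oo] --> pstar}).
Proof.
move=> Usub Uclosed Uconvex smoothZ _ noisy gapZ pert fresh bounds a0 a2 b0 theta0
  R00 beta_gt gamma00 Up1 p1_gt0 iter.
have Ssub : prod_set U `<=` simplices by move=> q Uq i; apply: Usub; exact: Uq.
have lim := ae_value_limit Usub Uclosed Uconvex smoothZ (noisy_measurable noisy)
  (perturbation_measurable pert) gapZ fresh bounds a0 a2 b0 theta0 R00 beta_gt
  gamma00 Up1 p1_gt0 iter.
split=> [|pstar uniq].
  apply: filterS lim => w [q [Uq gq Zq]].
  by apply: (dist_set_cvg0 _ Zq); exists q.
apply: filterS lim => w [q [Uq gq Zq]].
have qE : q = pstar by apply/(pstar_stationary uniq Uq).
rewrite qE in Zq.
have Sp k : prod_set U (p k.+1 w) by exact: (iterate_feasible Uconvex a0 a2 Up1 iter).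
(* The iteration leaves [p 0] unconstrained, so feasibility starts at index 1. *)
rewrite -(cvg_shiftS (fun k => p k w))/=.
apply: (minimizing_sequence_cvg smoothZ Ssub (compact_prod_set Uclosed Ssub) Sp
  (pstar_feasible uniq) (pstar_minimizes uniq)).
by rewrite (cvg_shiftS (fun k => Z (p k w))).
Qed.
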